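(* Let $f\colon \mathbb{N} \to \mathbb{U}$ be a non-pretentious multiplicative function such that the set $\mathcal{P}=\{p\in \mathbb{P}: f(p)\neq 1\}$ has relative density $0$ in the primes. Then $f$ satisfies Elliott's conjecture.
   Context: $\mathbb{N}=\{1,2,3,\dots\}$; $\mathbb{U}$ is the closed unit disk of $\mathbb{C}$; $\mathbb{P}$ is the set of primes; $p$ always denotes a prime. A function $f\colon\mathbb{N}\to\mathbb{U}$ is multiplicative if $f(1)=1$ and $f(mn)=f(m)f(n)$ whenever $\gcd(m,n)=1$. Pretentious distance: for $g_1,g_2\colon\mathbb{N}\to\mathbb{U}$ and $x>0$ (or $x=\infty$), $\mathbb{D}(g_1,g_2;x)=\Big(\sum_{p\le x}\frac{1-\mathrm{Re}(g_1(p)\overline{g_2(p)})}{p}\Big)^{1/2}$. A multiplicative function $f\colon\mathbb{N}\to\mathbb{U}$ is pretentious if there exist a Dirichlet character $\chi$ and $t\in\mathbb{R}$ with $\mathbb{D}(f,\,n\mapsto\chi(n)n^{it};\infty)<\infty$; otherwise it is non-pretentious. A set $\mathcal{P}\subset\mathbb{P}$ has relative density $0$ in the primes if $\lim_{N\to\infty}\frac{|\mathcal{P}\cap\{1,\dots,N\}|}{|\mathbb{P}\cap\{1,\dots,N\}|}=0$. A multiplicative function $f\colon\mathbb{N}\to\mathbb{U}$ satisfies Elliott's conjecture if for every $k\in\mathbb{N}$ and all fixed positive integers $a_1,\dots,a_k,h_1,\dots,h_k$ with $a_ih_j\neq a_jh_i$ for all $i\neq j$, one has $\frac1x\sum_{n\le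 x}f(a_1n+h_1)\cdots f(a_kn+h_k)\to 0$ as $x\to\infty$. *)

(* Defs.v *)
From HB Require Import structures.
From mathcomp Require Import all_boot all_order all_algebra.
From mathcomp Require Import complex.
From mathcomp Require Import all_classical all_reals all_analysis.

Set Implicit Arguments.
Unset Strict Implicit.
Unset Printing Implicit Defensive.

Import Order.TTheory GRing.Theory Num.Theory.
Import numFieldNormedType.Exports.

Local Open Scope classical_set_scope.
Local Open Scope complex_scope.
Local Open Scope ring_scope.

(* Arithmetic functions on the positive integers are represented by functions  *)
(* nat -> R[i]; their values at 0 are irrelevant and left unconstrained.       *)

Definition unit_disk_valued (R : realType) (f : nat -> R[i]) : Prop :=
  forall n : nat, (0 < n)%N -> `|f n| <= 1.

Definition multiplicative_function (R : realType) (f : nat -> R[i]) : Prop :=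
  f 1%N = 1 /\
  forall m n : nat, (0 < m)%N -> (0 < n)%N -> coprime m n ->
    f (m * n)%N = f m * f n.

(* Dirichlet characters as q-periodic, completely multiplicative functions     *)
(* whose support is the set of integers coprime to q.                          *)
Definition dirichlet_character (R : realType) (q : nat) (chi : nat -> R[i]) :
    Prop :=
  [/\ (0 < q)%N,
      forall m n : nat, chi (m * n)%N = chi m * chi n,
      forall n : nat, chi (n + q)%N = chi n &
      forall n : nat, (chi n != 0) = coprime n q].

(* n^(it) = exp(i t log n), for n > 0 *)
Definition nat_pow_it (R : realType) (t : R) (n : nat) : R[i] :=
  cos (t * ln n%:R) +i* sin (t * ln n%:R).

(* The terms of the series are nonnegative when g1 and g2 take values in the   *)
(* closed unit disk, so the sum is well defined in \bar R, also at x = +oo.    *)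
Definition pretentious_distance (R : realType) (g1 g2 : nat -> R[i])
    (x : \bar R) : \bar R :=
  sqrte (\sum_(0 <= p <oo | prime p && (p%:R%:E <= x))
    ((1 - complex.Re (g1 p * (g2 p)^*)) / p%:R)%:E)%E.

Definition pretentious (R : realType) (f : nat -> R[i]) : Prop :=
  exists (q : nat) (chi : nat -> R[i]) (t : R),
    dirichlet_character q chi /\
    (pretentious_distance f (fun n => chi n * nat_pow_it t n)%R +oo < +oo)%E.

Definition count_upto (P : pred nat) (N : nat) : nat :=
  (\sum_(1 <= n < N.+1 | P n) 1)%N.

Definition relative_density0_in_primes (R : realType) (P : pred nat) : Prop :=
  (count_upto P N)%:R / (count_upto prime N)%:R @[N --> \oo] --> (0 : R).

(* R[i]^o is R[i] with the topology of the complex modulus. *)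
Definition satisfies_elliott (R : realType) (f : nat -> R[i]) : Prop :=
  forall (k : nat) (a h : 'I_k -> nat),
    (0 < k)%N ->
    (forall i, (0 < a i)%N) ->
    (forall i, (0 < h i)%N) ->
    (forall i j, i != j -> (a i * h j != a j * h i)%N) ->
    x%:C^-1 * (\sum_(1 <= n < (Num.truncn x).+1)
                  \prod_(i < k) f (a i * n + h i)%N)
      @[x --> (+oo : set_system R)] --> (0 : R[i]^o).

(* Main.v *)
Require Import Defs.
From HB Require Import structures.
From mathcomp Require Import all_boot all_order all_algebra.
From mathcomp Require Import complex.
From mathcomp Require Import all_classical all_reals all_analysis.
From mathcomp Require Import zify ring lra.

(** Non-pretentiousness, applied to the trivial character and t = 0, says that
    the sum of (1 - Re f(p))/p over the primes diverges.  Write P for the set of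
    primes with f(p) <> 1; only these contribute.

    Fix w, large in terms of the forms a_i n + h_i.  For all but a small
    proportion of n, no p^e with p <= w and no p^2 with p > w divides any of
    the a_i n + h_i, and then (correlation_factor) the product of the
    f(a_i n + h_i) is H(n) F(n).  Here H is periodic with values in the unit disk, and F(n)
    is the product of f(p) over the p in P, p > w, that divide some
    a_i n + h_i; for a given n, such a p divides at most one of them.  If n
    behaved independently modulo the primes p in P, w < p <= z, the mean of F
    cut at z would be the Euler product of the 1 + (f(p) - 1) k/p.  That
    product tends to 0 as z grows, by divergence (euler_product_small).

    The sparsity of P justifies independence for z a small power of the length
    N of the sum.  By Chebyshev's bound the sum of 1/p over P in a block
    (2^2^i, 2^2^(i+1)] tends to 0 with i (block_sum).  First, the primes of P
    between z and a constant multiple of N fill only boundedly many blocks, so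
    they divide the a_i n + h_i for a negligible proportion of n.  Secondly, a
    Brun sieve on the primes of P up to z works in dimension close to 0: in
    the block lying u below the top, the inclusion-exclusion is cut after
    products of fewer than u primes.  The remainder of the sieve stays below a
    constant times the square root of N however many blocks there are
    (tower_level), and if the blocks have mass at most eta, the cut in that block costs eta^u on average,
    a total of O(eta) (tower_excess).

    Two devices keep the sieve elementary.  Functions of n are expanded into
    indicators of residue classes, so that means over coprime moduli multiply
    by the Chinese remainder theorem (has_meanM).  The cut is controlled by a
    Bonferroni inequality for complex weights (bonferroni), whose error term is
    itself such an expansion, so no bound for the cut products at exceptional
    n is required. *)

Set Implicit Arguments.
Unset Strict Implicit.
Unset Printing Implicit Defensive.
Import Order.TTheory GRing.Theory Num.Theory.
Import numFieldNormedType.Exports.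

(** * Primes up to powers of two *)

Lemma prime_dvd_fact_leq p n : prime p -> p %| n`! -> p <= n.
Proof.
move=> pp; elim: n => [|n IH]; first by rewrite fact0 dvdn1 => /eqP p1; rewrite p1 in pp.
rewrite factS Euclid_dvdM // => /orP[/dvdn_leq -> //|/IH]; exact: leqW.
Qed.

Lemma dvdn_prod_primes (s : seq nat) m : uniq s ->
  {in s, forall p, prime p /\ p %| m} -> \prod_(p <- s) p %| m.
Proof.
elim: s => [|p s IH] /=; first by rewrite big_nil dvd1n.
move=> /andP[ps us] H; have [pp pm] := H p (mem_head _ _).
have Hs : {in s, forall q, prime q /\ q %| m}.
  by move=> q qs; apply: H; rewrite inE qs orbT.
rewrite big_cons Gauss_dvd ?pm ?IH //.
rewrite big_seq; apply: (big_ind (coprime p)) => [|a b pa pb|q qs].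
- by rewrite coprimen1.
- by rewrite coprimeMr pa.
- have [pq _] := Hs q qs; rewrite prime_coprime // dvdn_prime2 //.
  by apply: contraNN ps => /eqP ->.
Qed.

Lemma bin_leq_exp2 n m : 'C(n, m) <= 2 ^ n.
Proof.
elim: n m => [|n IH] [|m]; rewrite ?bin0 ?expn_gt0 // binS expnS mul2n -addnn.
by rewrite leq_add.
Qed.

(** Every prime in (2^l, 2^(l+1)] divides the binomial coefficient
    'C(2^(l+1), 2^l), which is at most 2^(2^(l+1)), while their product exceeds
    2^l to the power of their number. *)
Lemma count_primes_dyadic l :
  l * \sum_((2 ^ l).+1 <= p < (2 ^ l.+1).+1 | prime p) 1 <= 2 ^ l.+1.
Proof.
rewrite sum1_count -size_filter; set s := [seq p <- _ | prime p].
have sP p : p \in s -> [/\ prime p, 2 ^ l < p & p <= 2 ^ l.+1].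
  by rewrite mem_filter mem_index_iota => /and3P[-> -> ].
have dv : \prod_(p <- s) p %| 'C(2 ^ l.+1, 2 ^ l).
  apply: dvdn_prod_primes; first by rewrite filter_uniq ?iota_uniq.
  move=> p /sP[pp p1 p2]; split => //.
  have : p %| (2 ^ l.+1)`! by rewrite dvdn_fact // prime_gt0.
  have -> : 2 ^ l.+1 = 2 ^ l + 2 ^ l by rewrite expnS mul2n addnn.
  rewrite -(@bin_fact _ (2 ^ l)) ?leq_addr // addnK !Euclid_dvdM //.
  by case: (boolP (p %| (2 ^ l)`!)) => [/(prime_dvd_fact_leq pp)|_]; rewrite ?orbF // leqNgt p1.
rewrite -(@leq_exp2l 2) // expnM.
apply: leq_trans (leq_trans (dvdn_leq _ dv) (bin_leq_exp2 _ _)).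
  elim: s sP {dv} => [|p s IH] sP /=; first by rewrite big_nil expn0.
  rewrite big_cons expnS leq_mul //.
    by have [_ /ltnW] := sP p (mem_head _ _).
  by apply: IH => q qs; apply: sP; rewrite inE qs orbT.
by rewrite bin_gt0 leq_exp2l.
Qed.

(** Chebyshev's upper bound.  Writing a_m for the count, (m + 1) a_(m+1) is the
    sum of m (a_(m+1) - a_m), m a_m and a_(m+1): these are controlled by the
    dyadic estimate, by induction and by the trivial bound a_(m+1) <= 2^(m+1). *)
Lemma chebyshev_pow2 m : m * \sum_(1 <= p < (2 ^ m).+1 | prime p) 1 <= 4 * 2 ^ m.
Proof.
elim: m => [//|m IH].
have le1 : \sum_(1 <= p < (2 ^ m.+1).+1 | prime p) 1 <= 2 ^ m.+1.
  rewrite big_mkcond (leq_trans (leq_sum _ (E2 := fun=> 1) _)) //.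
    by move=> i _; case: prime.
  by rewrite sum_nat_const_nat subn1 muln1.
have := count_primes_dyadic m.
have : \sum_(1 <= p < (2 ^ m.+1).+1 | prime p) 1 =
   \sum_(1 <= p < (2 ^ m).+1 | prime p) 1 + \sum_((2 ^ m).+1 <= p < (2 ^ m.+1).+1 | prime p) 1.
  by rewrite (@big_cat_nat _ _ _ (2 ^ m).+1) //= ltnS leq_exp2l.
move: le1 IH; rewrite expnS; nia.
Qed.

Local Open Scope complex_scope.
Local Open Scope ring_scope.

Section BlockSums.
Variable R : realFieldType.

Lemma dyadic_sum (P : pred nat) (d : R) l :
  (\sum_(1 <= n < (2 ^ l.+1).+1 | P n) 1)%N%:R
     <= d * (\sum_(1 <= n < (2 ^ l.+1).+1 | prime n) 1)%N%:R ->
  0 <= d ->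
  \sum_((2 ^ l).+1 <= p < (2 ^ l.+1).+1 | P p) p%:R^-1 <= 8 * d / l.+1%:R.
Proof.
move=> H d0; set s := (X in X <= _).
have l0 : 0 < 2 ^+ l :> R by rewrite exprn_gt0.
have h1 : s * 2 ^+ l <= (\sum_(1 <= n < (2 ^ l.+1).+1 | P n) 1)%N%:R.
  rewrite (@big_cat_nat _ _ _ (2 ^ l).+1) //= ?ltnS ?leq_exp2l //.
  apply: (@le_trans _ _ (\sum_((2 ^ l).+1 <= i < (2 ^ l.+1).+1 | P i) 1)%N%:R).
    rewrite natr_sum mulr_suml big_seq_cond [leRHS]big_seq_cond; apply: ler_sum => p /andP[].
    rewrite mem_index_iota => /andP[lp _] _.
    by rewrite -natrX mulrC ler_pdivrMr ?mul1r ?ler_nat ?ltr0n ?(ltnW lp) //; lia.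
  by rewrite ler_nat leq_addl.
have : l.+1%:R * (\sum_(1 <= n < (2 ^ l.+1).+1 | prime n) 1)%N%:R <= 8 * 2 ^+ l :> R.
  rewrite -natrM (le_trans (_ : _ <= (4 * 2 ^ l.+1)%N%:R)) ?ler_nat ?chebyshev_pow2 //.
  by rewrite expnS !natrM natrX mulrA -natrM.
set pi := (\sum_(1 <= n < _ | prime n) 1)%N%:R in H *.
move=> h2; rewrite ler_pdivlMr ?ltr0n //.
rewrite -(ler_pM2r l0) mulrAC.
have h3 := ler_wpM2r (ler0n R l.+1) (le_trans h1 H).
have h4 := ler_wpM2l d0 h2.
rewrite [leRHS](_ : _ = d * (8 * 2 ^+ l)); last by ring.
by apply: le_trans h3 _; rewrite -mulrA [pi * _]mulrC.
Qed.

(** A doubly exponential block consists of 2^i dyadic intervals, to each of which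
    Chebyshev's bound gives a mass O(d / 2^i); the total does not grow with i. *)
Lemma block_sum (P : pred nat) (d : R) i : 0 <= d ->
  (forall N, (2 ^ 2 ^ i <= N)%N -> (\sum_(1 <= n < N.+1 | P n) 1)%N%:R
     <= d * (\sum_(1 <= n < N.+1 | prime n) 1)%N%:R) ->
  \sum_((2 ^ 2 ^ i).+1 <= p < (2 ^ 2 ^ i.+1).+1 | P p) p%:R^-1 <= 8 * d.
Proof.
move=> d0 H; set a := (2 ^ i)%N.
have a0 : (0 < a)%N by rewrite expn_gt0.
have -> : (2 ^ i.+1 = a + a)%N by rewrite expnS mul2n addnn.
suff S j : \sum_((2 ^ a).+1 <= p < (2 ^ (a + j)).+1 | P p) p%:R^-1 <= j%:R * (8 * d / a%:R).
  by apply: le_trans (S a) _; rewrite mulrC divfK // pnatr_eq0 -lt0n.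
elim: j => [|j IH]; first by rewrite addn0 big_geq // mul0r.
rewrite (@big_cat_nat _ _ _ (2 ^ (a + j)).+1) //= ?ltnS ?leq_exp2l ?leq_addr ?addnS //.
rewrite -natr1 mulrDl mul1r lerD //.
apply: le_trans (dyadic_sum _ d0) _.
  by apply: H; rewrite leq_exp2l // -addnS leq_addr.
rewrite ler_wpM2l ?mulr_ge0 // lef_pV2 ?posrE ?ltr0n // ler_nat; lia.
Qed.

End BlockSums.

(** * Means of combinations of residue classes *)

(** The shift d - r %% d turns the class of r into the multiples of d. *)
Lemma count_residue_divn (d r N : nat) : (0 < d)%N ->
  (\sum_(1 <= n < N.+1) (n == r %[mod d]) + (d - r %% d) %/ d
   = (N + (d - r %% d)) %/ d)%N.
Proof.
move=> d0; elim: N => [|N IH]; first by rewrite big_geq.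
rewrite big_nat_recr //= addnAC IH addSn divnS // addnC; congr (_ + _)%N.
rewrite /dvdn -addSn.
rewrite -(modn_mod r d) -(eqn_modDr (d - r %% d)).
by rewrite subnKC ?modnn ?modn_mod // (ltnW (ltn_pmod r d0)).
Qed.

Lemma count_residue (K : numFieldType) (d r N : nat) : (0 < d)%N ->
  `|\sum_(1 <= n < N.+1) (n == r %[mod d])%:R - N%:R / d%:R| <= 1 :> K.
Proof.
move=> d0; rewrite -natr_sum.
set c := (\sum_(1 <= n < N.+1) _)%N.
have cE := count_residue_divn r N d0; rewrite -/c in cE.
have [h1 h2] : (d * c <= N + d /\ N <= d * c + d)%N.
  have rd := ltn_pmod r d0.
  have := leq_trunc_div (N + (d - r %% d)) d.
  have := ltn_ceil (N + (d - r %% d)) d0.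
  rewrite -cE.
  case: (posnP (r %% d)) => [->|r0].
    rewrite subn0 divnn d0; nia.
  rewrite (divn_small (_ : d - r %% d < d)%N); [nia|lia].
have dK : 0 < d%:R :> K by rewrite ltr0n.
rewrite -(ler_pM2r dK) mul1r -[X in _ * X <= _](gtr0_norm dK) -normrM mulrBl divfK ?gt_eqF //.
rewrite -natrM mulnC real_ler_norml ?rpredB ?realn //.
by rewrite lerBlDr -natrD ler_nat addnC h1 lerBrDr addrC lerBlDr -natrD ler_nat h2.
Qed.

(** Multiples of d are counted among the values a n + h and not among residues of
    n: the bound (a N + h) / d has no additive error, so it remains useful for
    d larger than N. *)
Lemma count_dvd_affine (a h d N : nat) : (0 < d)%N -> (0 < a)%N ->
  (\sum_(1 <= n < N.+1) (d %| a * n + h) <= (a * N + h) %/ d)%N.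
Proof.
move=> d0 a0; elim: N => [|N IH]; first by rewrite big_geq.
rewrite big_nat_recr //=.
case: (boolP (d %| _)%N) => [dv|_]; last first.
  by rewrite addn0 (leq_trans IH) // leq_div2r // leq_add2r leq_mul2l leqnSn orbT.
rewrite addn1 (leq_ltn_trans IH) // ltn_divLR // divnK //.
by rewrite ltn_add2r ltn_mul2l a0 ltnSn.
Qed.

Section Mean.
Variable K : numFieldType.
Implicit Types (G : nat -> K) (B : nat_pred) (m : K) (T : nat).

(** G is a combination of indicators of residue classes whose moduli have all
    their prime factors in B; m is the mean that this expansion predicts and T
    bounds its coefficients.  Keeping an expansion, and not only its mean, is
    what lets such functions be multiplied. *)
Definition has_mean B G m T : Prop :=
  exists l : seq (K * nat * nat),
  [/\ all (fun t => B.-nat t.2) l,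
      forall n, G n = \sum_(t <- l) t.1.1 *+ (n == t.1.2 %[mod t.2]),
      m = \sum_(t <- l) t.1.1 / t.2%:R
    & \sum_(t <- l) `|t.1.1| <= T%:R].

Lemma has_mean_weaken B B' G G' m m' T T' : has_mean B G m T ->
  {subset B <= B'} -> G =1 G' -> m = m' -> (T <= T')%N ->
  has_mean B' G' m' T'.
Proof.
move=> [l [lB lG lm lT]] BB GG <- TT; exists l; split => //.
- by apply: sub_all lB => t; apply: sub_in_pnat => p _; exact: BB.
- by move=> n; rewrite -GG lG.
- by rewrite (le_trans lT) // ler_nat.
Qed.

Lemma has_mean_const B c T : `|c| <= T%:R -> has_mean B (fun=> c) c T.
Proof.
move=> cT; exists [:: (c, 0%N, 1%N)]; split => //=.
- by move=> n; rewrite big_seq1 !modn1 eqxx.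
- by rewrite big_seq1 divr1.
- by rewrite big_seq1.
Qed.

Lemma has_meanD B G1 G2 m1 m2 T1 T2 :
  has_mean B G1 m1 T1 -> has_mean B G2 m2 T2 ->
  has_mean B (fun n => G1 n + G2 n) (m1 + m2) (T1 + T2).
Proof.
move=> [l1 [B1 E1 M1 t1]] [l2 [B2 E2 M2 t2]]; exists (l1 ++ l2); split.
- by rewrite all_cat B1.
- by move=> n; rewrite big_cat E1 E2.
- by rewrite big_cat M1 M2.
- by rewrite big_cat natrD lerD.
Qed.

Lemma has_mean_sum I (s : seq I) B (G : I -> nat -> K) (m : I -> K)
    (T : I -> nat) :
  (forall i, has_mean B (G i) (m i) (T i)) ->
  has_mean B (fun n => \sum_(i <- s) G i n) (\sum_(i <- s) m i)
    (\sum_(i <- s) T i)%N.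
Proof.
move=> H; elim: s => [|i s IH].
  apply: (@has_mean_weaken B B (fun=> 0) _ 0 _ 0) => //; rewrite ?big_nil //.
  - by apply: has_mean_const; rewrite normr0.
  - by move=> n; rewrite big_nil.
apply: (has_mean_weaken (has_meanD (H i) IH)) => //; rewrite ?big_cons //.
by move=> n; rewrite big_cons.
Qed.

(** The Chinese remainder theorem: coprime residue conditions are independent. *)
Lemma has_meanM B1 B2 B G1 G2 m1 m2 T1 T2 :
  (forall p, p \in B1 -> p \notin B2) ->
  {subset B1 <= B} -> {subset B2 <= B} ->
  has_mean B1 G1 m1 T1 -> has_mean B2 G2 m2 T2 ->
  has_mean B (fun n => G1 n * G2 n) (m1 * m2) (T1 * T2).
Proof.
move=> dis sB1 sB2 [l1 [P1 E1 M1 t1]] [l2 [P2 E2 M2 t2]].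
exists [seq (t.1.1 * t'.1.1, chinese t.2 t'.2 t.1.2 t'.1.2, (t.2 * t'.2)%N)
   | t <- l1, t' <- l2]; split.
- apply/allP => _ /allpairsP[[t t'] /= [/(allP P1) /= h /(allP P2) /= h' ->]] /=.
  rewrite pnatM (sub_in_pnat _ h) ?(sub_in_pnat _ h') //.
    by move=> p _; exact: sB2.
  by move=> p _; exact: sB1.
- move=> n; rewrite big_allpairs_dep /= E1 E2 big_distrl /=.
  rewrite big_seq [RHS]big_seq; apply: eq_bigr => t /(allP P1) /= h.
  rewrite big_distrr /= big_seq [RHS]big_seq; apply: eq_bigr => t' /(allP P2) /= h'.
  have co : coprime t.2 t'.2.
    apply: (@pnat_coprime B1) => //.
    apply: (sub_in_pnat _ h') => p _ pB2.
    by rewrite !inE; apply: contraL pB2; exact: dis.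
  rewrite chinese_remainder // chinese_modl // chinese_modr //.
  by case: eqP => _; case: eqP => _; rewrite ?mulr1n ?mulr0n ?mulr0 ?mul0r.
- rewrite big_allpairs_dep /= M1 M2 big_distrl /=; apply: eq_bigr => t _.
  by rewrite big_distrr; apply: eq_bigr => t' _ /=; rewrite natrM invfM mulrACA.
- rewrite big_allpairs_dep /= natrM.
  apply: le_trans (ler_pM _ _ t1 t2); rewrite ?sumr_ge0 //.
  rewrite big_distrl /=; apply: ler_sum => t _.
  by rewrite big_distrr; apply: ler_sum => t' _ /=; rewrite normrM.
Qed.

Lemma has_meanZ B G m T c (C : nat) : `|c| <= C%:R ->
  has_mean B G m T -> has_mean B (fun n => c * G n) (c * m) (C * T).
Proof.
move=> cC; apply: (has_meanM (B1 := pred0)) => //.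
by apply: has_mean_const.
Qed.

Lemma has_mean_periodic B G (M : nat) : B.-nat M ->
  (forall n, G (n %% M)%N = G n) -> (forall n, `|G n| <= 1) ->
  has_mean B G ((\sum_(r < M) G r) / M%:R) M.
Proof.
move=> BM per G1; have M0 : (0 < M)%N by case/andP: BM.
exists [seq (G (val r), val r, M) | r : 'I_M <- index_enum 'I_M]; split.
- by apply/allP => _ /mapP[r _ ->].
- move=> n; rewrite big_map /= (bigD1 (Ordinal (ltn_pmod n M0))) //= big1 ?addr0.
    by rewrite modn_mod eqxx per.
  move=> r; rewrite -val_eqE /= => rn.
  by rewrite (modn_small (ltn_ord r)) eq_sym (negPf rn).
- by rewrite big_map /= mulr_suml.
- rewrite big_map /= (@le_trans _ _ (\sum_(r < M) 1)) ?ler_sum //.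
  by rewrite sumr_const card_ord.
Qed.

(** Each residue class of modulus d meets [1, N] in N/d + O(1) points, so the
    coefficient bound is an error term independent of N. *)
Lemma has_meanP B G m T N : has_mean B G m T ->
  `|\sum_(1 <= n < N.+1) G n - N%:R * m| <= T%:R.
Proof.
move=> [l [lB lG -> lT]]; apply: le_trans lT.
under eq_bigr do rewrite lG.
rewrite exchange_big /= mulr_sumr -sumrB.
apply: le_trans (ler_norm_sum _ _ _) _.
rewrite big_seq [leRHS]big_seq; apply: ler_sum => t /(allP lB) /= /andP[t0 _].
under eq_bigr do rewrite -mulr_natr.
rewrite -mulr_sumr mulrCA -mulrBr normrM ler_piMr //.
exact: count_residue.
Qed.

End Mean.

(** * Truncated inclusion-exclusion *)

Section Bonferroni.
Variable K : numFieldType.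
Implicit Types (x y : nat -> K) (s : seq nat) (r : nat).

(** Elementary symmetric polynomial of degree r in the x q, q in s, defined by the
    recursion on which all the estimates run. *)
Fixpoint elsym r x s : K :=
  match r, s with
  | 0, _ => 1
  | _.+1, [::] => 0
  | r'.+1, q :: s' => elsym r x s' + x q * elsym r' x s'
  end.

Definition elsym_lt r x s : K := \sum_(i < r) elsym i x s.

Lemma elsym0 x s : elsym 0 x s = 1. Proof. by case: s. Qed.

Lemma elsym_lt_cons r x q s :
  elsym_lt r.+1 x (q :: s) = elsym_lt r.+1 x s + x q * elsym_lt r x s.
Proof.
rewrite /elsym_lt big_ord_recl [in RHS]big_ord_recl elsym0 /= elsym0 -addrA.
by rewrite mulr_sumr -big_split.
Qed.

(** Both the error of the cut product and the bound satisfy E_(r+1)(q :: s) =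
    E_(r+1)(s) + z E_r(s), with z = x q for the error and z = |x q| for the
    bound.  The disk condition enters at r = 0, where it says that the full
    product has modulus at most 1. *)
Lemma bonferroni x s r : {in s, forall q, `|1 + x q| <= 1} ->
  `|\prod_(q <- s) (1 + x q) - elsym_lt r x s| <= elsym r (fun q => `|x q|) s.
Proof.
elim: s r => [|q s IH] r H.
  rewrite big_nil /elsym_lt; case: r => [|r]; first by rewrite big_ord0 subr0 normr1.
  by rewrite big_ord_recl /= big1 ?addr0 ?subrr ?normr0 // => i _.
have Hs : {in s, forall q, `|1 + x q| <= 1}.
  by move=> p ps; rewrite H // inE ps orbT.
case: r => [|r].
  rewrite /elsym_lt big_ord0 subr0 /= normr_prod big_seq prodr_ile1 // => p ps.
  by rewrite normr_ge0 H.
rewrite elsym_lt_cons big_cons /=.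
have -> : (1 + x q) * (\prod_(j <- s) (1 + x j)) - (elsym_lt r.+1 x s + x q * elsym_lt r x s)
  = (\prod_(j <- s) (1 + x j) - elsym_lt r.+1 x s)
    + x q * (\prod_(j <- s) (1 + x j) - elsym_lt r x s) by ring.
apply: le_trans (ler_normD _ _) _; rewrite normrM.
by apply: lerD; [exact: IH|rewrite ler_wpM2l // IH].
Qed.

Lemma eq_elsym r x y s : x =1 y -> elsym r x s = elsym r y s.
Proof. by move=> xy; elim: s r => [|q s IH] [|r] //=; rewrite !IH xy. Qed.

Lemma elsym_ge0 r y s : {in s, forall q, 0 <= y q} -> 0 <= elsym r y s.
Proof.
elim: s r => [|q s IH] [|r] //= y0.
have ys : {in s, forall p, 0 <= y p} by move=> p ps; rewrite y0 // inE ps orbT.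
by rewrite addr_ge0 ?mulr_ge0 ?IH // y0 ?mem_head.
Qed.

(** Each monomial of degree r in distinct variables occurs in the expansion of the
    r-th power of their sum. *)
Lemma elsym_le_exp r y s (e : K) : {in s, forall q, 0 <= y q} ->
  \sum_(q <- s) y q <= e -> elsym r y s <= e ^+ r.
Proof.
have S0 t : {in t, forall q, 0 <= y q} -> 0 <= \sum_(q <- t) y q.
  by move=> yt; rewrite big_seq sumr_ge0.
move=> y0 se; suff : elsym r y s <= (\sum_(q <- s) y q) ^+ r.
  move/le_trans; apply; apply: lerXn2r => //; rewrite nnegrE ?(le_trans _ se) // S0 //.
elim: s r y0 {se} => [|q s IH] [|r] //= y0; first by rewrite big_nil expr0n.
have ys : {in s, forall p, 0 <= y p} by move=> p ps; rewrite y0 // inE ps orbT.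
have yq : 0 <= y q by rewrite y0 ?mem_head.
have {}S0 := S0 s ys.
rewrite big_cons; set S := \sum_(j <- s) y j in S0 *.
apply: (@le_trans _ _ (S ^+ r.+1 + y q * S ^+ r)).
  by rewrite lerD ?ler_wpM2l ?IH.
rewrite exprS -mulrDl exprS addrC ler_wpM2l ?addr_ge0 //.
by rewrite lerXn2r ?nnegrE ?addr_ge0 // lerDr.
Qed.

Lemma has_mean_elsym r s (g : nat -> nat -> K) (m : nat -> K) (b : nat) :
  uniq s -> {in s, forall q, has_mean (pred1 q) (g q) (m q) b} ->
  has_mean [pred p in s] (fun n => elsym r (fun q => g q n) s) (elsym r m s)
    ((b * size s + 2) ^ r).
Proof.
elim: s r => [|q s IH] r /=.
  move=> _ _; case: r => [|r]; apply: has_mean_const; rewrite ?normr1 ?normr0 //.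
case: r => [|r] /andP[qs us] H; first by apply: has_mean_const; rewrite normr1.
have Hs : {in s, forall q, has_mean (pred1 q) (g q) (m q) b}.
  by move=> p ps; apply: H; rewrite inE ps orbT.
have h2 : has_mean [pred p in q :: s] (fun n => g q n * elsym r (fun q => g q n) s)
   (m q * elsym r m s) (b * (b * size s + 2) ^ r).
  apply: (has_meanM _ _ _ (H q (mem_head _ _)) (IH r us Hs)) => p; rewrite ?inE.
  - by move/eqP->.
  - by move=> ->.
  - by move=> ps; apply/orP; right.
have h1 : has_mean [pred p in q :: s] (fun n => elsym r.+1 (fun q => g q n) s)
    (elsym r.+1 m s) ((b * size s + 2) ^ r.+1).
  apply: (has_mean_weaken (IH r.+1 us Hs)) => // p ps.
  by rewrite !inE; apply/orP; right.
apply: (has_mean_weaken (has_meanD h1 h2)) => //.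
rewrite expnS -mulnDl expnS mulnS leq_mul //; first lia.
by case: r {IH h1 h2} => // r; rewrite leq_exp2r //; lia.
Qed.

Lemma has_mean_elsym_lt r s (g : nat -> nat -> K) (m : nat -> K) (b : nat) :
  uniq s -> {in s, forall q, has_mean (pred1 q) (g q) (m q) b} ->
  has_mean [pred p in s] (fun n => elsym_lt r (fun q => g q n) s) (elsym_lt r m s)
    ((b * size s + 2) ^ r).
Proof.
move=> us H.
apply: (has_mean_weaken (has_mean_sum _ (fun i : 'I_r => has_mean_elsym i us H))) => //.
elim: r => [|r IH]; first by rewrite big_ord0.
rewrite big_ord_recr /= expnS; set X := (b * _ + 2)%N in IH *.
by rewrite (leq_trans (leq_add IH (leqnn _))) // addnn -mul2n leq_mul // leq_addl.
Qed.

End Bonferroni.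

(** * A sieve in blocks *)

Section Blocks.
Variable K : numFieldType.

(** Replacing the factors one at a time: F V' is within U V' of V V', and the
    partial product V' of the others is at most the product of the 1 + U. *)
Lemma prod_approx (I : eqType) (s : seq I) (F V U : I -> K) :
  {in s, forall i, `|F i| <= 1} -> {in s, forall i, `|F i - V i| <= U i} ->
  `|\prod_(i <- s) F i - \prod_(i <- s) V i| <= \prod_(i <- s) (1 + U i) - 1.
Proof.
elim: s => [|i s IH] F1 FV; first by rewrite !big_nil !subrr normr0.
have U0 : {in i :: s, forall j, 0 <= U j}.
  by move=> j js; rewrite (le_trans _ (FV j js)).
have V1 : {in i :: s, forall j, `|V j| <= 1 + U j}.
  move=> j js; rewrite -[V j](subKr (F j)) (le_trans (ler_normB _ _)) //.
  by rewrite lerD ?F1 ?FV.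
have sS j : j \in s -> j \in i :: s by rewrite inE => ->; rewrite orbT.
have is_ := mem_head i s.
have {}IH := IH (fun j js => F1 j (sS j js)) (fun j js => FV j (sS j js)).
rewrite !big_cons.
set PF := \prod_(j <- s) F j in IH *; set PV := \prod_(j <- s) V j in IH *.
set PU := \prod_(j <- s) (1 + U j) in IH *.
have -> : F i * PF - V i * PV = F i * (PF - PV) + (F i - V i) * PV by ring.
have -> : (1 + U i) * PU - 1 = (PU - 1) + U i * PU by ring.
apply: le_trans (ler_normD _ _) _; rewrite !normrM lerD //.
  by rewrite (le_trans _ IH) // ler_piMl // F1.
rewrite ler_pM ?FV //.
rewrite /PV /PU normr_prod big_seq [leRHS]big_seq; apply: ler_prod => j js.
by rewrite normr_ge0 V1 ?sS.
Qed.

Lemma has_mean_prod (I : eqType) (bs : seq I) (Q : I -> seq nat)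
   (G : I -> nat -> K) (m : I -> K) (T : I -> nat) :
  uniq (flatten (map Q bs)) ->
  {in bs, forall i, has_mean [pred p in Q i] (G i) (m i) (T i)} ->
  has_mean [pred p in flatten (map Q bs)] (fun n => \prod_(i <- bs) G i n)
    (\prod_(i <- bs) m i) (\prod_(i <- bs) T i)%N.
Proof.
elim: bs => [|i bs IH] /=.
  move=> _ _; apply: (@has_mean_weaken _ [pred p in Nil nat] _ (fun=> 1) _ 1 _ 1) => //.
  - by apply: has_mean_const; rewrite normr1.
  - by move=> n; rewrite big_nil.
  - by rewrite big_nil.
  - by rewrite big_nil.
rewrite cat_uniq => /and3P[_ /hasPn dis ubs] H.
have Hbs : {in bs, forall i, has_mean [pred p in Q i] (G i) (m i) (T i)}.
  by move=> j jbs; apply: H; rewrite inE jbs orbT.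
have h : has_mean [pred p in Q i ++ flatten (map Q bs)]
    (fun n => G i n * \prod_(j <- bs) G j n)
    (m i * \prod_(j <- bs) m j) (T i * \prod_(j <- bs) T j)%N.
  apply: (has_meanM _ _ _ (H i (mem_head _ _)) (IH ubs Hbs)) => p; rewrite ?inE.
  - by move=> pQ; apply/negP => /dis /=; rewrite pQ.
  - by rewrite /= mem_cat => ->.
  - by rewrite /= mem_cat => ->; rewrite orbT.
apply: (has_mean_weaken h) => //; rewrite ?big_cons //.
by move=> n; rewrite big_cons.
Qed.

(** E q n is an event, such as a divisibility by q, that depends on n modulo q
    and has probability th q.  Each entry b of bs lists in b.2 the primes of a block and in b.1 the
    degree at which its inclusion-exclusion is cut.  The cut is made twice, in
    the true product and in the Euler product of the 1 + (g q - 1) th q, and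
    both times the errors multiply up to at most the product of the 1 + U less
    1; hence the factor 2. *)
Lemma block_sieve (bs : seq (nat * seq nat)) (B0 : nat_pred) (H : nat -> K)
    (h : K) (M : nat) (E : nat -> pred nat) (th g : nat -> K) (k N : nat) :
  let Q := flatten (map snd bs) in
  uniq Q -> {in B0, forall p, p \notin Q} ->
  has_mean B0 H h M -> (forall n, `|H n| <= 1) -> `|h| <= 1 ->
  {in Q, forall q, has_mean (pred1 q) (fun n => (E q n)%:R) (th q) k} ->
  {in Q, forall q, `|g q| <= 1} -> {in Q, forall q, 0 <= th q <= 1} ->
  `|\sum_(1 <= n < N.+1) H n * \prod_(q <- Q) (1 + (g q - 1) * (E q n)%:R)| <=
    N%:R * (`|\prod_(q <- Q) (1 + (g q - 1) * th q)| +
      2 * (\prod_(b <- bs) (1 + elsym b.1 (fun q => `|g q - 1| * th q) b.2) - 1))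
    + (M.+1 * \prod_(b <- bs) (2 * k * size b.2 + 2) ^ b.1.+1)%:R.
Proof.
move=> Q uQ B0Q Hh H1 h1 Eth g1 th01.
pose x n q := (g q - 1) * (E q n)%:R.
pose y q := (g q - 1) * th q.
have bQ b q : b \in bs -> q \in b.2 -> q \in Q.
  by move=> bbs qb; apply/flatten_mapP; exists b.
have ub : {in bs, forall b, uniq b.2}.
  move=> b bbs; move: uQ; rewrite /Q; elim: (bs) bbs => //= a s IH.
  rewrite inE cat_uniq => /predU1P[->|bs_] /and3P[// _ _]; exact: IH.
have g2 q : q \in Q -> `|g q - 1| <= 2%:R.
  move=> qQ; apply: le_trans (ler_normB _ _) _; rewrite normr1.
  have -> : 2%:R = 1 + 1 :> K by [].
  by rewrite lerD2r g1.
have x1 n q : q \in Q -> `|1 + x n q| <= 1.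
  move=> qQ; rewrite /x; case: (E q n); last by rewrite mulr0 addr0 normr1.
  by rewrite mulr1 addrC subrK g1.
have y1 q : q \in Q -> `|1 + y q| <= 1.
  move=> qQ; have /andP[t0 t1] := th01 q qQ.
  have -> : 1 + y q = (1 - th q) + th q * g q by rewrite /y; ring.
  apply: le_trans (ler_normD _ _) _; rewrite normrM (ger0_norm t0).
  apply: (@le_trans _ _ (1 - th q + th q)); last by rewrite subrK.
  by rewrite (@ger0_norm _ (1 - _)) ?subr_ge0 // lerD2l ler_piMr // g1.
set Qp := [pred p | p \in Q] : nat_pred.
(* V and v are the cut factors of a block, U and u their Bonferroni errors:
   capitals for a given n, lower case for the Euler product. *)
pose V n (b : nat * seq nat) := elsym_lt b.1 (x n) b.2.
pose U n (b : nat * seq nat) := elsym b.1 (fun q => `|x n q|) b.2.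
pose v (b : nat * seq nat) := elsym_lt b.1 y b.2.
pose u (b : nat * seq nat) := elsym b.1 (fun q => `|g q - 1| * th q) b.2.
pose T := (\prod_(b <- bs) (2 * k * size b.2 + 2) ^ b.1.+1)%N.
have VT : has_mean Qp (fun n => \prod_(b <- bs) V n b) (\prod_(b <- bs) v b) T.
  apply: (has_mean_prod uQ) => b bbs.
  have := @has_mean_elsym_lt _ b.1 b.2 (fun q n => x n q) y (2 * k) (ub b bbs).
  move=> /(_ _) hm; apply: (has_mean_weaken (hm _)) => //.
    by move=> q qb; apply: has_meanZ; [exact: g2 (bQ _ _ bbs qb)|exact: Eth (bQ _ _ bbs qb)].
  by rewrite leq_pexp2l // addn2.
have UT : has_mean Qp (fun n => \prod_(b <- bs) (1 + U n b)) (\prod_(b <- bs) (1 + u b)) T.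
  apply: (has_mean_prod (G := fun b n => 1 + U n b) uQ) => b bbs.
  have := @has_mean_elsym _ b.1 b.2 (fun q n => `|g q - 1| * (E q n)%:R)
    (fun q => `|g q - 1| * th q) (2 * k) (ub b bbs).
  move=> /(_ _) hm.
  have c1 : has_mean [pred p in b.2] (fun=> 1 : K) 1 1.
    by apply: has_mean_const; rewrite normr1.
  apply: (has_mean_weaken (has_meanD c1 (hm _))) => //.
  - move=> q qb; apply: has_meanZ; last exact: Eth (bQ _ _ bbs qb).
    by rewrite normr_id; exact: g2 (bQ _ _ bbs qb).
  - move=> n /=; congr (1 + _); apply: eq_elsym => q.
    by rewrite /x normrM normr_nat.
  - rewrite expnS; set Y := (_ ^ b.1)%N.
    have : (0 < Y)%N by rewrite expn_gt0 addn2.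
    by rewrite mulnDl; lia.
have PQ z : \prod_(q <- Q) z q = \prod_(b <- bs) \prod_(q <- b.2) z q :> K.
  by rewrite /Q big_flatten big_map.
have FV n : `|\prod_(q <- Q) (1 + x n q) - \prod_(b <- bs) V n b| <=
    \prod_(b <- bs) (1 + U n b) - 1.
  rewrite PQ; apply: prod_approx => b bbs.
    rewrite normr_prod big_seq prodr_ile1 // => q qb.
    by rewrite normr_ge0 x1 // (bQ b).
  by apply: bonferroni => q qb; rewrite x1 // (bQ b).
have fv : `|\prod_(q <- Q) (1 + y q) - \prod_(b <- bs) v b| <=
    \prod_(b <- bs) (1 + u b) - 1.
  rewrite PQ; apply: prod_approx => b bbs.
    rewrite normr_prod big_seq prodr_ile1 // => q qb.
    by rewrite normr_ge0 y1 // (bQ b).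
  apply: le_trans (bonferroni _ _) _.
    by move=> q qb; rewrite y1 // (bQ b).
  rewrite /u; move: (bQ b) => {}bQ; elim: b.2 b.1 (bQ^~ bbs) => [|q s IH] [|r] //= sQ.
  have sQ' p : p \in s -> p \in Q by move=> ps; apply: sQ; rewrite inE ps orbT.
  have /andP[t0 _] := th01 q (sQ q (mem_head _ _)).
  rewrite lerD ?IH // /y normrM (ger0_norm t0) ler_wpM2l ?IH //.
  by rewrite mulr_ge0.
have HVT : has_mean (predU B0 Qp) (fun n => H n * \prod_(b <- bs) V n b)
    (h * \prod_(b <- bs) v b) (M * T).
  apply: (has_meanM _ _ _ Hh VT) => p pB; first exact: B0Q.
    by rewrite inE; apply/orP; left.
  by rewrite inE; apply/orP; right.
have /(has_meanP N) hv := HVT.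
have /(has_meanP N) hu := UT.
have -> : \sum_(1 <= n < N.+1) H n * \prod_(q <- Q) (1 + x n q) =
  \sum_(1 <= n < N.+1) H n * (\prod_(q <- Q) (1 + x n q) - \prod_(b <- bs) V n b)
  + ((\sum_(1 <= n < N.+1) H n * \prod_(b <- bs) V n b
       - N%:R * (h * \prod_(b <- bs) v b)) + N%:R * (h * \prod_(b <- bs) v b)).
  by rewrite subrK -big_split; apply: eq_bigr => n _ /=; ring.
have s1 : `|\sum_(1 <= n < N.+1) H n * (\prod_(q <- Q) (1 + x n q) - \prod_(b <- bs) V n b)|
   <= N%:R * (\prod_(b <- bs) (1 + u b) - 1) + T%:R.
  apply: le_trans (ler_norm_sum _ _ _) _.
  apply: (@le_trans _ _ (\sum_(1 <= n < N.+1) (\prod_(b <- bs) (1 + U n b) - 1))).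
    by apply: ler_sum => n _; rewrite normrM (le_trans _ (FV n)) // ler_piMl.
  rewrite sumrB sumr_const_nat subn1 /= mulrBr mulr1 addrAC lerD2r -lerBlDl.
  apply: le_trans hu; apply: real_ler_norm.
  rewrite rpredB // ?rpredM ?realn //.
    rewrite ger0_real // sumr_ge0 // => n _; rewrite prodr_ge0 // => b _.
    by rewrite addr_ge0 // elsym_ge0.
  rewrite big_seq rpred_prod // => b bbs.
  rewrite ger0_real // addr_ge0 // elsym_ge0 // => q qb.
  by have /andP[t0 _] := th01 q (bQ b q bbs qb); rewrite mulr_ge0.
have v1 : `|\prod_(b <- bs) v b| <= `|\prod_(q <- Q) (1 + y q)| + (\prod_(b <- bs) (1 + u b) - 1).
  by rewrite -[X in `|X|](subKr (\prod_(q <- Q) (1 + y q))) (le_trans (ler_normB _ _)) // lerD.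
have v2 : `|N%:R * (h * \prod_(b <- bs) v b)| <=
   N%:R * (`|\prod_(q <- Q) (1 + y q)| + (\prod_(b <- bs) (1 + u b) - 1)).
  by rewrite !normrM normr_nat ler_wpM2l // (le_trans _ v1) // ler_piMl.
apply: le_trans (ler_normD _ _) _.
apply: (le_trans (lerD s1 (le_trans (ler_normD _ _) (lerD hv v2)))).
rewrite mulSn natrD -/T; set a := _ - 1; set c := `|_|.
by rewrite le_eqVlt; apply/orP; left; apply/eqP; ring.
Qed.

End Blocks.

(** * Factoring the values of a multiplicative function *)

Lemma dvd_affine_residue a h q : (0 < a)%N -> (0 < q)%N -> coprime a q ->
  exists r, forall n, (q %| a * n + h)%N = (n == r %[mod q])%N.
Proof.
move=> a0 q0 co; case: (egcdnP q a0) => u v /= uv _; rewrite (eqP co) in uv.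
exists (u * (q.-1 * h))%N => n.
have e0 : (a * (u * (q.-1 * h)) + h = 0 %[mod q])%N.
  have -> : (a * (u * (q.-1 * h)) + h = (v * (q.-1 * h) + h) * q)%N.
    by rewrite !mulnA [(a * u)%N]mulnC uv; case: q q0 {co uv} => // q _ /=; ring.
  by rewrite modnMl mod0n.
rewrite /dvdn -{1}(mod0n q) -e0 eqn_modDr.
(* Adding a multiple of q to n makes the difference of the two sides a natural
   number. *)
wlog le : n / (u * (q.-1 * h) <= n)%N.
  move=> W; have := W (u * (q.-1 * h) * q + n)%N.
  by rewrite mulnDr [(a * (_ * q))%N]mulnA !modnMDl; apply;
    rewrite (leq_trans (leq_pmulr _ q0)) ?leq_addr.
by rewrite !eqn_mod_dvd ?leq_mul // -mulnBr Gauss_dvdr // coprime_sym.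
Qed.

Lemma pnat_fact_exp w k : [pred p | (p <= w)%N].-nat (w`! ^ k)%N.
Proof.
rewrite pnatX; apply/orP; left; apply/pnatP; first exact: fact_gt0.
by move=> p pp /(prime_dvd_fact_leq pp).
Qed.

Section Factor.
Variable K : numFieldType.
Variable f : nat -> K.
Hypothesis f1 : f 1%N = 1.
Hypothesis fM : forall m n : nat, (0 < m)%N -> (0 < n)%N -> coprime m n ->
    f (m * n)%N = f m * f n.

Lemma mult_prod_parts (s : seq nat) m : uniq s -> {in s, forall p, prime p} ->
  f (\prod_(p <- s) m`_p)%N = \prod_(p <- s) f m`_p.
Proof.
elim: s => [|p s IH] /=; first by rewrite !big_nil f1.
move=> /andP[ps us] H.
have Hs : {in s, forall q, prime q} by move=> q qs; rewrite H // inE qs orbT.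
rewrite !big_cons fM ?part_gt0 ?IH //; first exact: prodn_gt0.
apply: (@pnat_coprime p); first exact: part_pnat.
rewrite big_seq; apply: (big_ind (fun n => p^'.-nat n)) => // [a b pa pb|q qs].
  by rewrite pnatM pa.
apply: sub_in_pnat (part_pnat q m) => l _ /eqnP ->; rewrite !inE.
by apply: contraNN ps => /eqP <-.
Qed.

Lemma mult_primes m : (0 < m)%N -> f m = \prod_(p <- primes m) f m`_p.
Proof.
move=> m0; rewrite -mult_prod_parts ?primes_uniq //; last first.
  by move=> p; rewrite mem_primes => /andP[].
congr f; rewrite {1}(prod_prime_decomp m0) prime_decompE big_map /=.
by apply: eq_bigr => p _; rewrite p_part.
Qed.

(** The gcd with w!^k is the w-smooth part of m as soon as no p^k with p <= w
    divides m.  The complementary part is squarefree, and its primes count only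
    where f is not 1. *)
Lemma mult_factor (w k z : nat) (Q : seq nat) m : uniq Q ->
  (forall p, (p \in Q) = [&& prime p, f p != 1 & (w < p <= z)%N]) ->
  (0 < m)%N ->
  (forall p, prime p -> (p <= w)%N -> ~~ (p ^ k %| m)%N) ->
  (forall p, prime p -> (w < p)%N -> ~~ (p ^ 2 %| m)%N) ->
  (forall p, prime p -> (z < p)%N -> f p != 1 -> ~~ (p %| m)%N) ->
  f m = f (gcdn m (w`! ^ k)) * \prod_(p <- Q) (if (p %| m)%N then f p else 1).
Proof.
move=> uQ QP m0 small sqf large.
set pi := [pred p | (p <= w)%N] : nat_pred.
have W0 : (0 < w`! ^ k)%N by rewrite expn_gt0 fact_gt0.
have Wpi : pi.-nat (w`! ^ k)%N := pnat_fact_exp w k.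
have <- : (m`_pi)%N = gcdn m (w`! ^ k).
  have -> : gcdn m (w`! ^ k) = gcdn (w`! ^ k) (m`_pi * m`_pi^').
    by rewrite partnC // gcdnC.
  rewrite Gauss_gcdl; last exact: pnat_coprime Wpi (part_pnat _ _).
  apply: esym; apply/gcdn_idPr.
  apply/dvdn_partP; first exact: part_gt0.
  move=> p; rewrite mem_primes => /and3P[pp _ pm].
  have pw : (p <= w)%N by have /(pnatP _ (part_gt0 pi m)) := part_pnat pi m; apply.
  have pm' : ~~ (p ^ k %| m`_pi)%N.
    by apply: contra (small p pp pw) => /dvdn_trans; apply; exact: dvdn_part.
  rewrite p_part; apply: (@dvdn_trans (p ^ k)).
    apply: dvdn_exp2l; rewrite pfactor_dvdn ?part_gt0 // -ltnNge in pm'.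
    exact: ltnW.
  by rewrite dvdn_exp2r // dvdn_fact // prime_gt0.
rewrite -{1}(partnC pi m0) fM ?part_gt0 ?coprime_partC //; congr (_ * _).
rewrite mult_primes ?part_gt0 // -big_mkcond -[RHS]big_filter primes_part.
set s := [seq x <- _ | _].
have sP p : p \in s -> [/\ prime p, (p %| m)%N & (w < p)%N].
  by rewrite mem_filter mem_primes !inE -ltnNge => /and4P[].
rewrite (eq_big_seq (fun p => f p)); last first.
  move=> p /[dup] ps /sP[pp pm wp]; congr f; rewrite p_part.
  suff -> : logn p m`_pi^' = 1%N by rewrite expn1.
  apply/eqP; rewrite eqn_leq logn_gt0 primes_part ps andbT.
  apply: leq_trans (dvdn_leq_log p m0 (dvdn_part pi^' m)) _.
  by rewrite leqNgt -pfactor_dvdn // sqf.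
rewrite (bigID (fun p => f p == 1)) /= big1 ?mul1r; last by move=> p /eqP.
rewrite -big_filter; apply: perm_big; apply: uniq_perm; rewrite ?filter_uniq ?primes_uniq //.
move=> p; rewrite !mem_filter QP mem_primes m0 !inE -ltnNge /=.
case: (boolP (prime p)) => pp; rewrite ?andbF //=.
case: (boolP (f p == 1)) => fp; rewrite ?andbF //=.
case: (boolP (p %| m)%N) => pm; rewrite ?andbF //= andbT.
rewrite [(p <= z)%N]leqNgt; case: (boolP (z < p)%N) => [zp|_]; last by rewrite andbT.
by have := large p pp zp fp; rewrite pm.
Qed.

End Factor.

(** * Products of a multiplicative function along linear forms *)

(** Counts the obstructions to factoring f(m) through the primes up to z: high
    powers of primes up to w, squares of larger primes, primes of P above z.
    In the first two sums p runs over all integers, whose reciprocal powers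
    already have small sums. *)
Definition bad_divisors (P : pred nat) (w e z Y m : nat) : nat :=
  (\sum_(2 <= p < w.+1) (p ^ e %| m) + \sum_(w.+1 <= p < Y.+1) (p ^ 2 %| m)
   + \sum_(z.+1 <= p < Y.+1 | P p) (p %| m))%N.

Lemma sum_bad_divisors (R : realFieldType) (P : pred nat) w e z Y a h N :
  (0 < a)%N -> (0 < w)%N ->
  (\sum_(1 <= n < N.+1) bad_divisors P w e z Y (a * n + h))%N%:R <=
  (a * N + h)%:R * (w%:R / 2 ^+ e + w%:R^-1
     + \sum_(z.+1 <= p < Y.+1 | P p) p%:R^-1) :> R.
Proof.
move=> a0 w0; set X := (a * N + h)%N.
have cnt d : (0 < d)%N -> (\sum_(1 <= n < N.+1) (d %| a * n + h))%N%:R <= X%:R / d%:R :> R.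
  move=> d0; rewrite ler_pdivlMr ?ltr0n // -natrM ler_nat.
  by rewrite (leq_trans _ (leq_trunc_div X d)) // leq_mul2r count_dvd_affine ?orbT.
have X0 : 0 <= X%:R :> R by rewrite ler0n.
move: X%:R X0 cnt => {X} X X0 cnt.
rewrite /bad_divisors !big_split /= !natrD !mulrDr !lerD //.
- rewrite exchange_big natr_sum /=.
  apply: (@le_trans _ _ (\sum_(2 <= p < w.+1) X / 2 ^+ e)).
    rewrite big_seq [leRHS]big_seq; apply: ler_sum => p.
    rewrite mem_index_iota => /andP[p2 _]; apply: le_trans (cnt _ _) _.
      by rewrite expn_gt0 (leq_trans _ p2).
    rewrite ler_wpM2l // lef_pV2 ?posrE ?exprn_gt0 ?ltr0n ?expn_gt0 ?(leq_trans _ p2) //.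
    by rewrite natrX lerXn2r ?nnegrE ?ler0n // ler_nat.
  rewrite sumr_const_nat -[_ *+ (w.+1 - 2)]mulr_natl [leLHS]mulrCA ler_wpM2l //.
  by rewrite ler_wpM2r ?invr_ge0 ?exprn_ge0 // ler_nat; lia.
- rewrite exchange_big natr_sum /=.
  (* 1/p^2 <= 1/(p - 1) - 1/p *)
  apply: (@le_trans _ _ (\sum_(w.+1 <= p < Y.+1) X * (p.-1%:R^-1 - p%:R^-1))).
    rewrite big_seq [leRHS]big_seq; apply: ler_sum => p.
    rewrite mem_index_iota => /andP[wp _]; apply: le_trans (cnt _ _) _.
      by rewrite expn_gt0 (leq_trans _ wp).
    rewrite ler_wpM2l //; case: p wp => // p wp /=.
    have p0 : 0 < p%:R :> R by rewrite ltr0n; lia.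
    have p1 : 0 < p.+1%:R :> R by rewrite ltr0n.
    have -> : p%:R^-1 - p.+1%:R^-1 = (p%:R * p.+1%:R)^-1 :> R.
      by rewrite -natr1; field; rewrite !gt_eqF // natr1.
    by rewrite lef_pV2 ?posrE ?mulr_gt0 // ?ltr0n // -natrM ler_nat; lia.
  rewrite -mulr_sumr ler_wpM2l //.
  case: (leqP w Y) => wY; last by rewrite big_geq ?invr_ge0 ?ler0n // ltnW.
  rewrite big_add1 /= (telescope_sumr_eq (fun p => - p%:R^-1)) //.
    by rewrite opprK addrC lerBlDr lerDl invr_ge0 ler0n.
  by move=> i _; rewrite opprK addrC.
- rewrite exchange_big natr_sum /= mulr_sumr big_seq_cond [leRHS]big_seq_cond.
  apply: ler_sum => p; rewrite mem_index_iota => /andP[/andP[zp _] _].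
  by apply: cnt; rewrite (leq_trans _ zp).
Qed.

Section Correlation.
Variables (K : numFieldType) (f : nat -> K).
Hypothesis f1 : f 1%N = 1.
Hypothesis fM : forall m n : nat, (0 < m)%N -> (0 < n)%N -> coprime m n ->
    f (m * n)%N = f m * f n.
Hypothesis fU : forall n : nat, (0 < n)%N -> `|f n| <= 1.
Variables (k : nat) (a h : 'I_k -> nat) (w : nat).
Hypothesis a0 : forall i, (0 < a i)%N.
Hypothesis h0 : forall i, (0 < h i)%N.
Hypothesis ah : forall i j, i != j -> (a i * h j != a j * h i)%N.
Hypothesis ahw : forall i j, (a i * h j <= w)%N.

Definition divides_some (q n : nat) : bool := [exists i, (q %| a i * n + h i)%N].

(** A common divisor q of a_i n + h_i and a_j n + h_j divides the difference of
    a_i h_j and a_j h_i, both of which are smaller than q. *)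
Lemma divides_inj q n i j : (w < q)%N ->
  (q %| a i * n + h i)%N -> (q %| a j * n + h j)%N -> i = j.
Proof.
move=> wq di dj; apply/eqP; apply: contraT => /ah/eqP [].
have lt i' j' : (a i' * h j' < q)%N := leq_ltn_trans (ahw i' j') wq.
have : (a j * (a i * n + h i) == a i * (a j * n + h j) %[mod q])%N.
  by rewrite -[X in X == _]modnMmr -[X in _ == X]modnMmr (eqP di) (eqP dj) !muln0.
have -> : (a j * (a i * n + h i) = a i * a j * n + a j * h i)%N by ring.
have -> : (a i * (a j * n + h j) = a i * a j * n + a i * h j)%N by ring.
by rewrite eqn_modDl !modn_small // => /eqP.
Qed.

Lemma has_mean_divides_some q : prime q -> (w < q)%N ->
  has_mean (pred1 q) (fun n => (divides_some q n)%:R : K) (k%:R / q%:R) k.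
Proof.
move=> qp wq.
have h1 i : has_mean (pred1 q) (fun n => (q %| a i * n + h i)%N%:R : K) (q%:R^-1) 1.
  have aq : (a i < q)%N.
    by apply: leq_ltn_trans wq; apply: leq_trans (ahw i i); exact: leq_pmulr.
  have co : coprime (a i) q by rewrite coprime_sym prime_coprime // gtnNdvd.
  have [r rE] := dvd_affine_residue (h i) (a0 i) (prime_gt0 qp) co.
  exists [:: (1, r, q)]; split; rewrite ?big_seq1 ?div1r ?normr1 //=.
    by rewrite andbT; exact: pnat_id.
  by move=> n; rewrite big_seq1 /= rE.
apply: (has_mean_weaken (has_mean_sum (index_enum 'I_k) h1)) => //.
- move=> n /=; rewrite /divides_some; case: (boolP [exists i, _]) => [/existsP[i di]|no].
    rewrite (bigD1 i) //= di big1 ?addr0 // => j ji.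
    case: (boolP (q %| _)%N) => // dj.
    by rewrite (divides_inj wq dj di) eqxx in ji.
  rewrite big1 // => i _; case: (boolP (q %| _)%N) => // di.
  by case/existsP: no; exists i.
- by rewrite sumr_const card_ord mulr_natl.
- by rewrite sum_nat_const card_ord muln1.
Qed.

Variables (e z : nat) (Q : seq nat).
Hypothesis uQ : uniq Q.
Hypothesis QP : forall p, (p \in Q) = [&& prime p, f p != 1 & (w < p <= z)%N].

(** The periodic factor: the gcd depends on n only modulo w!^e, and it is the whole
    w-smooth part of a_i n + h_i unless a high power of a small prime divides. *)
Definition smooth_part (n : nat) : K :=
  \prod_i f (gcdn (a i * n + h i) (w`! ^ e)).

Lemma smooth_part_le1 n : `|smooth_part n| <= 1.
Proof.
rewrite normr_prod prodr_ile1 // => i _; rewrite normr_ge0 fU //.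
by rewrite gcdn_gt0 expn_gt0 fact_gt0 orbT.
Qed.

Lemma smooth_part_periodic n : smooth_part (n %% (w`! ^ e)) = smooth_part n.
Proof.
apply: eq_bigr => i _; congr f.
by rewrite gcdnC -gcdn_modr -modnDml modnMmr modnDml gcdn_modr gcdnC.
Qed.

Lemma correlation_factor Y n : (forall i, (a i * n + h i <= Y)%N) ->
  (forall i, bad_divisors [pred p | prime p && (f p != 1)] w e z Y (a i * n + h i) = 0%N) ->
  \prod_i f (a i * n + h i)%N =
  smooth_part n * \prod_(q <- Q) (1 + (f q - 1) * (divides_some q n)%:R).
Proof.
move=> nY good.
have fE i : f (a i * n + h i)%N = f (gcdn (a i * n + h i) (w`! ^ e)) *
   \prod_(p <- Q) (if (p %| a i * n + h i)%N then f p else 1).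
  set m := (a i * n + h i)%N.
  have m0 : (0 < m)%N by rewrite addn_gt0 h0 orbT.
  have := good i; rewrite -/m /bad_divisors => /eqP; rewrite !addn_eq0 -!andbA => /and3P[].
  rewrite !sum_nat_seq_eq0 => /allP b1 /allP b2 /allP b3.
  apply: mult_factor => //.
  - move=> p pp pw; have := b1 p; rewrite mem_index_iota prime_gt1 // ltnS pw => /(_ isT).
    by case: (p ^ e %| m)%N.
  - move=> p pp wp; apply/negP => pm.
    have pY : (p <= Y)%N.
      apply: leq_trans (nY i); rewrite -/m; apply: dvdn_leq => //.
      by apply: dvdn_trans pm; exact: dvdn_mulr.
    by have := b2 p; rewrite mem_index_iota wp ltnS pY pm => /(_ isT).
  - move=> p pp zp fp; apply/negP => pm.
    have pY : (p <= Y)%N by apply: leq_trans (nY i); rewrite -/m; apply: dvdn_leq.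
    by have := b3 p; rewrite mem_index_iota zp ltnS pY pm /= pp fp => /(_ isT).
under eq_bigr do rewrite fE.
rewrite big_split /=; congr (_ * _).
rewrite exchange_big /= big_seq [RHS]big_seq; apply: eq_bigr => q.
rewrite QP => /and3P[_ _ /andP[wq _]].
rewrite /divides_some; case: (boolP [exists i, _]) => [/existsP[i di]|no].
  rewrite (bigD1 i) //= di big1 ?mulr1 ?(addrC 1) ?subrK // => j ji.
  case: (boolP (q %| _)%N) => // dj.
  by rewrite (divides_inj wq dj di) eqxx in ji.
rewrite mulr0 addr0 big1 // => i _; case: (boolP (q %| _)%N) => // di.
by case/existsP: no; exists i.
Qed.

(** The two summands agree when n has no bad divisor, and in general differ by at
    most 2 since both lie in the unit disk. *)
Lemma correlation_approx Y N : (forall i, (a i * N + h i <= Y)%N) ->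
  `|\sum_(1 <= n < N.+1) \prod_i f (a i * n + h i)%N -
    \sum_(1 <= n < N.+1) smooth_part n *
       \prod_(q <- Q) (1 + (f q - 1) * (divides_some q n)%:R)| <=
  2 * (\sum_i \sum_(1 <= n < N.+1)
     bad_divisors [pred p | prime p && (f p != 1%R)] w e z Y (a i * n + h i))%N%:R.
Proof.
move=> NY; rewrite exchange_big natr_sum mulr_sumr -sumrB /=.
apply: le_trans (ler_norm_sum _ _ _) _.
rewrite big_seq [leRHS]big_seq; apply: ler_sum => n; rewrite mem_index_iota => /andP[_ nN].
have nY i : (a i * n + h i <= Y)%N.
  by apply: leq_trans (NY i); rewrite leq_add2r leq_mul2l -ltnS nN orbT.
set b := (\sum_(i < k) _)%N.
case: (posnP b) => [b0|b0].
  rewrite (correlation_factor (Y := Y)) // ?subrr ?normr0 ?mulr_ge0 //.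
  by move=> i; move/eqP: b0; rewrite sum_nat_eq0 => /forallP/(_ i)/eqP.
apply: (@le_trans _ _ (1 + 1)).
  apply: le_trans (ler_normB _ _) _; apply: lerD.
    by rewrite normr_prod prodr_ile1 // => i _; rewrite normr_ge0 fU // addn_gt0 h0 orbT.
  rewrite normrM -[leRHS]mulr1 ler_pM ?smooth_part_le1 //.
  rewrite normr_prod big_seq prodr_ile1 // => q; rewrite QP => /and3P[qp _ _].
  rewrite normr_ge0 /=; case: divides_some; last by rewrite mulr0 addr0 normr1.
  by rewrite mulr1 addrC subrK fU // prime_gt0.
by apply: (@ler_peMr _ _ 2%:R); rewrite ?ler0n ?ler1n.
Qed.

End Correlation.

(** * Doubly exponential blocks *)

Section Tower.
Variable P : pred nat.

Definition block i := [seq p <- index_iota (2 ^ 2 ^ i).+1 (2 ^ 2 ^ i.+1).+1 | P p].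

(** The J blocks below 2^2^i, from the top: the u-th one is cut at degree u.  The
    degree must grow going down for the errors to be summable, and may grow
    because u 2^-u is summable. *)
Definition tower i J : seq (nat * seq nat) :=
  [seq (u, block (i - u)) | u <- iota 1 J].

Lemma tower_rcons i J :
  tower i J.+1 = rcons (tower i J) (J.+1, block (i - J.+1)).
Proof.
have iotaE : iota 1 J.+1 = iota 1 J ++ [:: J.+1] by rewrite -[J.+1]addn1 iotaD add1n addn1.
by rewrite /tower iotaE map_cat cats1.
Qed.

Lemma mem_block i p : (p \in block i) = P p && (2 ^ 2 ^ i < p <= 2 ^ 2 ^ i.+1)%N.
Proof. by rewrite mem_filter mem_index_iota ltnS. Qed.

Lemma leq_exp22 i j : (2 ^ 2 ^ i <= 2 ^ 2 ^ j)%N = (i <= j)%N.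
Proof. by rewrite !leq_exp2l. Qed.

Lemma mem_tower i J p : (J <= i)%N ->
  (p \in flatten (map snd (tower i J))) =
    P p && (2 ^ 2 ^ (i - J) < p <= 2 ^ 2 ^ i)%N.
Proof.
elim: J => [|J IH] Ji.
  by rewrite subn0 in_nil; apply/esym/negP => /and3P[_ ]; rewrite ltnNge => /negP.
rewrite tower_rcons map_rcons flatten_rcons mem_cat IH ?(ltnW Ji) // mem_block subnSK //.
have := leq_exp22 (i - J.+1) (i - J); have := leq_exp22 (i - J) i.
rewrite leq_sub2l // leq_subr; case: (P p) => //=.
by move=> h1 h2; apply/idP/idP; lia.
Qed.

Lemma uniq_tower i J : (J <= i)%N -> uniq (flatten (map snd (tower i J))).
Proof.
elim: J => [//|J IH] Ji.
rewrite tower_rcons map_rcons flatten_rcons cat_uniq IH ?(ltnW Ji) //=.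
rewrite filter_uniq ?iota_uniq // andbT; apply/hasPn => p /=.
rewrite mem_block mem_tower ?(ltnW Ji) // subnSK // => /and3P[_ _ le].
by rewrite (ltnNge _ p) le andbF.
Qed.

(** The u-th block contributes an exponent of at most (u + 1) 2^(i - u + 2), and
    the sum of (u + 1) / 2^u over u >= 1 is 3. *)
Lemma tower_level i J k : (J <= i)%N -> (2 * k + 2 <= 2 ^ 2 ^ (i - J))%N ->
  (\prod_(b <- tower i J) (2 * k * size b.2 + 2) ^ b.1.+1 <= 2 ^ 2 ^ (i + 4))%N.
Proof.
move=> Ji kJ.
(* The extra factor is the tail of the series of exponents, in closed form. *)
suff : (\prod_(b <- tower i J) (2 * k * size b.2 + 2) ^ b.1.+1 *
   2 ^ ((J + 3) * 2 ^ (i - J + 2)) <= 2 ^ (12 * 2 ^ i))%N.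
  move=> H; apply: (@leq_trans (2 ^ (12 * 2 ^ i))).
    by apply: leq_trans H; rewrite leq_pmulr // expn_gt0.
  by rewrite leq_exp2l // expnD mulnC leq_mul2l orbT.
elim: J Ji kJ => [|J IH] Ji kJ.
  by rewrite big_nil mul1n subn0 leq_exp2l // expnD; lia.
rewrite tower_rcons -cats1 big_cat big_seq1 /=.
have le1 : (2 ^ 2 ^ (i - J.+1) <= 2 ^ 2 ^ (i - J))%N by rewrite leq_exp22 leq_sub2l.
have {}IH := IH (ltnW Ji) (leq_trans kJ le1).
apply: leq_trans IH; rewrite -mulnA leq_mul2l; apply/orP; right.
have sz : (size (block (i - J.+1)) <= 2 ^ 2 ^ (i - J))%N.
  rewrite size_filter (leq_trans (count_size _ _)) // size_iota subnSK //.
  by rewrite subSS leq_subr.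
have sz2 : (2 * k * size (block (i - J.+1)) + 2 <= 2 ^ 2 ^ (i - J + 1))%N.
  rewrite expnD muln2 -addnn expnD.
  apply: (@leq_trans ((2 * k + 2) * 2 ^ 2 ^ (i - J))).
    rewrite mulnDl leq_add ?leq_mul //; have : (0 < 2 ^ 2 ^ (i - J))%N by rewrite expn_gt0.
    lia.
  by rewrite leq_mul2r (leq_trans kJ) ?orbT.
apply: (@leq_trans ((2 ^ 2 ^ (i - J + 1)) ^ J.+2 * 2 ^ ((J.+1 + 3) * 2 ^ (i - J.+1 + 2)))).
  by rewrite leq_mul2r leq_exp2r // sz2 orbT.
rewrite -expnM -expnD leq_exp2l //.
have -> : (i - J.+1 + 2 = i - J + 1)%N by lia.
by rewrite !addn2 addn1 !expnS; lia.
Qed.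

End Tower.

Section TowerSums.
Variable P : pred nat.

(** The u-th error is at most eta^u, hence at most eta / 4^(u-1), so the product is
    1 + O(eta) however many blocks there are. *)
Lemma tower_excess (K : numFieldType) i J (y : nat -> K) (eta : K) :
  (forall q, 0 <= y q) -> 0 <= eta -> 4 * eta <= 1 ->
  (forall u, (0 < u <= J)%N -> \sum_(q <- block P (i - u)) y q <= eta) ->
  \prod_(b <- tower P i J) (1 + elsym b.1 y b.2) - 1 <= 4 * eta.
Proof.
move=> y0 eta0 eta1 H.
suff : \prod_(b <- tower P i J) (1 + elsym b.1 y b.2) <= 1 + 4 * eta * (1 - 2 ^- J).
  by move=> h; rewrite lerBlDl (le_trans h) // lerD2l ler_piMr ?mulr_ge0.
elim: J H => [|J IH] H; first by rewrite big_nil invr1 subrr mulr0 addr0.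
rewrite tower_rcons -cats1 big_cat big_seq1 /=.
have u1 : elsym J.+1 y (block P (i - J.+1)) <= eta / 2 ^+ (2 * J).
  apply: le_trans (elsym_le_exp _ _ (H J.+1 _)) _ => //=.
  rewrite exprS ler_wpM2l // exprM -exprVn lerXn2r ?nnegrE ?invr_ge0 ?exprn_ge0 //.
  by rewrite -[leRHS]mul1r ler_pdivlMr ?exprn_gt0 // mulrC (_ : 2 ^+ 2 = 4) // -natrX.
set E := elsym _ _ _ in u1 *; set p := \prod_(_ <- _) _ in IH *.
have E0 : 0 <= E by apply: elsym_ge0.
have {}IH : p <= 1 + 4 * eta * (1 - 2 ^- J).
  by apply: IH => u /andP[u0 uJ]; apply: H; rewrite u0 leqW.
have p2 : p <= 2.
  apply: le_trans IH _; apply: (@le_trans _ _ (1 + 1)) => //; rewrite lerD2l.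
  by apply: le_trans eta1; rewrite ler_piMr ?mulr_ge0.
have E1 : E <= eta / 2 ^+ J.
  apply: le_trans u1 _; rewrite ler_wpM2l // lef_pV2 ?posrE ?exprn_gt0 //.
  by rewrite ler_weXn2l ?ler1n // leq_pmull.
rewrite mulrDr mulr1.
apply: (@le_trans _ _ (1 + 4 * eta * (1 - 2 ^- J) + 2 * (eta / 2 ^+ J))).
  rewrite lerD // ler_pM //.
  by rewrite prodr_ge0 // => b _; rewrite addr_ge0 // elsym_ge0.
rewrite le_eqVlt; apply/orP; left; apply/eqP.
by rewrite exprS; field; rewrite expf_eq0 pnatr_eq0 andbF.
Qed.

Lemma sum_blocks_le (R : realFieldType) (g : nat -> R) (rho : R) i j :
  (forall l, (i <= l)%N -> \sum_((2 ^ 2 ^ l).+1 <= p < (2 ^ 2 ^ l.+1).+1 | P p) g p <= rho) ->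
  \sum_((2 ^ 2 ^ i).+1 <= p < (2 ^ 2 ^ (i + j)).+1 | P p) g p <= j%:R * rho.
Proof.
move=> H; elim: j => [|j IH]; first by rewrite addn0 big_geq // mul0r.
rewrite (@big_cat_nat _ _ _ (2 ^ 2 ^ (i + j)).+1) //= ?ltnS ?leq_exp22 ?addnS //; try lia.
by rewrite -natr1 mulrDl mul1r lerD // H // leq_addr.
Qed.

End TowerSums.

(** * The main term *)

Section Complex.
Variable R : realType.
Implicit Types (f : nat -> R[i]).

Lemma Re_le1 (g : R[i]) : `|g| <= 1 -> complex.Re g <= 1.
Proof.
move=> g1; have := le_trans (normc_ge_Re g) g1.
by rewrite (_ : 1 = 1%:C) // lecR; apply: le_trans; exact: ler_norm.
Qed.

(** The left side is 1 - 2 th (1 - Re g) + th^2 |g - 1|^2, where |g - 1|^2 is at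
    most 2 (1 - Re g) on the unit disk. *)
Lemma norm_contraction (g : R[i]) (th : R) : `|g| <= 1 -> 0 <= th <= 2^-1 ->
  `|1 + (g - 1) * th%:C| ^+ 2 <= (1 - th * (1 - complex.Re g))%:C.
Proof.
move=> g1 /andP[t0 t1].
have : `|g| ^+ 2 <= 1 by rewrite exprn_ile1.
case: g {g1} => x y; rewrite -!add_Re2_Im2 /= (_ : 1 = 1%:C) // !lecR /=.
move=> h.
have x1 : 0 <= 1 - x by nra.
have h1 : 0 <= th ^+ 2 * (2 * (1 - x) - ((1 - x) ^+ 2 + y ^+ 2)).
  by rewrite mulr_ge0 ?exprn_ge0 //; lra.
have h2 : 0 <= (1 - 2 * th) * (th * (1 - x)) by rewrite !mulr_ge0 //; lra.
by lra.
Qed.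

(** The distance from f to the constant 1, that is, to the character modulo 1
    twisted by t = 0, is infinite. *)
Lemma nonpretentious_diverges f : unit_disk_valued f -> ~ pretentious f ->
  forall A : R, exists n : nat,
    A <= \sum_(0 <= p < n | prime p) (1 - complex.Re (f p)) / p%:R.
Proof.
move=> fU nonpret A; apply: contrapT => no; apply: nonpret.
have le n : \sum_(0 <= p < n | prime p) (1 - complex.Re (f p)) / p%:R <= A.
  by rewrite leNgt; apply/negP => /ltW lt; apply: no; exists n.
exists 1%N, (fun=> 1), 0; split.
  by split => // [m n|n]; rewrite ?mulr1 // coprimen1 oner_neq0.
rewrite /pretentious_distance.
have E p : (1 - complex.Re (f p * ((fun n => (1 : R[i]) * nat_pow_it (0 : R) n) p)^*)) / p%:R
   = (1 - complex.Re (f p)) / p%:R :> R.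
  rewrite /nat_pow_it mul0r cos0 sin0 mul1r.
  by case: (f p) => x y /=; rewrite oppr0 mulr0 mulr1 subr0.
have s0 p : prime p -> (0 <= ((1 - complex.Re (f p)) / p%:R)%:E)%E.
  move=> pp; rewrite lee_fin divr_ge0 ?ler0n // subr_ge0 Re_le1 // fU //.
  exact: prime_gt0.
rewrite (eq_eseriesr (g := fun p => ((1 - complex.Re (f p)) / p%:R)%:E)); last first.
  by move=> p _; rewrite E.
have le2 : (\sum_(0 <= p <oo | prime p && (p%:R%:E <= +oo :> \bar R)%E)
    ((1 - complex.Re (f p)) / p%:R)%:E <= A%:E)%E.
  pose P p := prime p && (p%:R%:E <= +oo :> \bar R)%E.
  have cv := @is_cvg_nneseries R (fun p => ((1 - complex.Re (f p)) / p%:R)%:E) P 0 _.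
  apply: (lime_le (cv _)); first by move=> n _ /andP[pn _]; exact: s0.
  apply: nearW => n; rewrite sumEFin lee_fin.
  rewrite (eq_bigl (fun p => prime p)) ?le // => p.
  by rewrite /P leey andbT.
rewrite ltey_eq sqrte_fin_num; last first.
  by apply: nneseries_ge0 => n _ /andP[pn _]; exact: s0.
rewrite ge0_fin_numE ?(le_lt_trans le2) ?ltry //.
by apply: nneseries_ge0 => n _ /andP[pn _]; exact: s0.
Qed.

(** The squared factors are at most 1 - k s_q <= 1 / (1 + s_q), where s_q is
    (1 - Re f(q)) / q, and the product of the 1 + s_q is at least 1 plus their
    sum. *)
Lemma euler_factors_decay f (k : nat) (Q : seq nat) : (0 < k)%N ->
  {in Q, forall q, `|f q| <= 1 /\ (2 * k <= q)%N} ->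
  `|\prod_(q <- Q) (1 + (f q - 1) * (k%:R / q%:R))| ^+ 2 <=
  ((1 + \sum_(q <- Q) (1 - complex.Re (f q)) / q%:R)^-1)%:C.
Proof.
move=> k0; elim: Q => [|q Q IH] H.
  by rewrite !big_nil normr1 expr1n addr0 invr1.
have HQ : {in Q, forall q, `|f q| <= 1 /\ (2 * k <= q)%N}.
  by move=> p pQ; apply: H; rewrite inE pQ orbT.
have s0 p : p \in Q -> 0 <= (1 - complex.Re (f p)) / p%:R :> R.
  by move=> /HQ[fp _]; rewrite divr_ge0 ?ler0n // subr_ge0 Re_le1.
have S0 : 0 <= \sum_(p <- Q) (1 - complex.Re (f p)) / p%:R.
  by rewrite big_seq sumr_ge0.
rewrite !big_cons normrM exprMn; have {}IH := IH HQ.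
have [fq kq] := H q (mem_head _ _).
have q0 : 0 < q%:R :> R by rewrite ltr0n; lia.
have k1 : 1 <= k%:R :> R by rewrite ler1n.
have kq2 : 2 * k%:R <= q%:R :> R by rewrite -natrM ler_nat.
pose th : R := k%:R / q%:R.
have th01 : 0 <= th <= 2^-1.
  by rewrite divr_ge0 ?ler0n //= ler_pdivrMr // ler_pdivlMl.
have -> : k%:R / q%:R = th%:C by rewrite /th rmorphM fmorphV !rmorph_nat.
apply: (le_trans (ler_pM _ _ (norm_contraction fq th01) IH)); rewrite ?exprn_ge0 //.
rewrite -rmorphM lecR.
set S := \sum_(_ <- _) _ in S0 *.
have : 0 <= 1 - complex.Re (f q) by rewrite subr_ge0 Re_le1.
set r := 1 - complex.Re (f q) => r0.
have rq0 : 0 <= r / q%:R by rewrite divr_ge0 // ltW.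
have S1 : 0 < 1 + S by rewrite ltr_wpDr.
have rS1 : 0 < 1 + (r / q%:R + S) by rewrite ltr_wpDr // addr_ge0.
rewrite ler_pdivrMr // [leRHS]mulrC ler_pdivlMr //.
have thr : r / q%:R <= th * r.
  by rewrite /th mulrAC ler_wpM2r ?invr_ge0 ?(ltW q0) // ler_peMl.
move: (r / q%:R) rq0 thr {rS1} => s rs thr.
by nra.
Qed.

End Complex.

(** * Choice of the parameters *)

Section Assembly.
Variable R : realType.

Lemma leq_exp22_id n : (n <= 2 ^ 2 ^ n)%N.
Proof.
by apply: leq_trans (ltnW (ltn_expl _ (ltnSn 1))); apply: ltnW; exact: ltn_expl.
Qed.

Lemma density0_count (P : pred nat) (d : R) : 0 < d ->
  relative_density0_in_primes R P ->
  exists N0, forall N, (N0 <= N)%N ->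
    (\sum_(1 <= n < N.+1 | P n) 1)%N%:R
      <= d * (\sum_(1 <= n < N.+1 | prime n) 1)%N%:R.
Proof.
move=> d0 /cvgrPdist_le/(_ d d0)[N0 _ H]; exists (maxn N0 2) => N.
rewrite geq_max => /andP[N0N N2]; have := H N N0N.
rewrite /= sub0r normrN ger0_norm ?divr_ge0 ?ler0n // ler_pdivrMr // ltr0n.
by rewrite /count_upto big_mkcond (bigD1_seq 2%N) ?mem_index_iota ?iota_uniq.
Qed.

(** The relative density of P tends to 0, so the constant d of block_sum can be
    taken arbitrarily small for late blocks. *)
Lemma block_sums_small (P : pred nat) (rho : R) : 0 < rho ->
  relative_density0_in_primes R P ->
  exists i0, forall i, (i0 <= i)%N ->
    \sum_((2 ^ 2 ^ i).+1 <= p < (2 ^ 2 ^ i.+1).+1 | P p) p%:R^-1 <= rho.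
Proof.
move=> rho0 /(density0_count (divr_gt0 rho0 (ltr0n _ 8)))[N0 H].
exists N0 => i N0i; have -> : rho = 8 * (rho / 8) by rewrite mulrC divfK ?pnatr_eq0.
apply: block_sum => [|N iN]; first by rewrite divr_ge0 ?(ltW rho0) ?ler0n.
apply: H; apply: leq_trans iN; apply: leq_trans N0i _; exact: leq_exp22_id.
Qed.

Lemma natr_unbounded (x : R) : exists n : nat, x <= n%:R.
Proof. by exists (Num.truncn x).+1; exact/ltW/truncnS_gt. Qed.

(** All errors for one N.  The sieve uses the blocks i - J, ..., i - 1; the primes
    of P from 2^2^i up to the largest value a_j N + h_j lie in the next 7 blocks.
    The term 16 k rho is the sieve's excess, with eta = 2 k rho. *)
Lemma correlation_bound (f : nat -> R[i]) (k : nat) (a h : 'I_k -> nat)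
    (rho : R) (e i J t N A : nat) :
  let P := [pred p | prime p && (f p != 1)] in
  let w := (2 ^ 2 ^ (i - J))%N in
  let Q := flatten (map snd (tower P i J)) in
  unit_disk_valued f -> multiplicative_function f ->
  (0 < k)%N -> (forall i, (0 < a i)%N) -> (forall i, (0 < h i)%N) ->
  (forall i j, i != j -> (a i * h j != a j * h i)%N) ->
  (forall i j, (a i * h j <= w)%N) ->
  (2 * k + 2 <= w)%N -> (J <= i)%N -> (t = i + 5)%N ->
  (2 ^ 2 ^ t <= N < 2 ^ 2 ^ t.+1)%N ->
  (\sum_i (a i + h i) <= A)%N -> (A <= N)%N ->
  0 <= rho -> 8 * k%:R * rho <= 1 ->
  (forall l, (i - J <= l)%N ->
     \sum_((2 ^ 2 ^ l).+1 <= p < (2 ^ 2 ^ l.+1).+1 | P p) p%:R^-1 <= rho) ->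
  `|\sum_(1 <= n < N.+1) \prod_j f (a j * n + h j)%N| <=
    (N%:R * (2 * A%:R * (w%:R / 2 ^+ e + w%:R^-1 + 7 * rho) + 16 * k%:R * rho)
     + ((w`! ^ e).+1 * 2 ^ 2 ^ (i + 4))%:R)%:C
    + N%:R * `|\prod_(q <- Q) (1 + (f q - 1) * (k%:R / q%:R))|.
Proof.
move=> P w Q fU [f1 fM] k0 a0 h0 ah ahw kw Ji tE /andP[tN Nt] AP AN rho0 rho1 H.
set z := (2 ^ 2 ^ i)%N; set Y := (2 ^ 2 ^ (i + 7))%N.
have uQ : uniq Q by exact: uniq_tower.
have QP p : (p \in Q) = [&& prime p, f p != 1 & (w < p <= z)%N].
  by rewrite mem_tower //= -andbA.
have w0 : (0 < w)%N by rewrite expn_gt0.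
have N0 : (0 < N)%N by apply: leq_trans tN; rewrite expn_gt0.
have aA j : (a j * N + h j <= A * N)%N.
  apply: (@leq_trans ((a j + h j) * N)); first by rewrite mulnDl leq_add2l leq_pmulr.
  by rewrite leq_mul2r (leq_trans _ AP) ?orbT // (bigD1 j) //= leq_addr.
(* A N <= N^2 < 2^2^(t + 2), and t + 2 = i + 7. *)
have NY j : (a j * N + h j <= Y)%N.
  apply: leq_trans (aA j) _; apply: (@leq_trans (N * N)); first by rewrite leq_mul2r AN orbT.
  have -> : Y = (2 ^ 2 ^ t.+1 * 2 ^ 2 ^ t.+1)%N.
    by rewrite -expnD addnn -mul2n -expnS /Y tE; congr (2 ^ 2 ^ _)%N; lia.
  by rewrite leq_mul // ltnW.
have approx := correlation_approx f1 fM fU h0 ah ahw e uQ QP NY.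
set S1 := \sum_(1 <= n < N.+1) _ in approx *; set S2 := \sum_(1 <= n < N.+1) _ in approx.
have bad : (\sum_j \sum_(1 <= n < N.+1) bad_divisors P w e z Y (a j * n + h j))%N%:R
    <= A%:R * N%:R * (w%:R / 2 ^+ e + w%:R^-1 + 7 * rho) :> R.
  have tau : \sum_(z.+1 <= p < Y.+1 | P p) p%:R^-1 <= 7 * rho.
    by apply: sum_blocks_le => l il; apply: H; rewrite (leq_trans (leq_subr _ _) il).
  have c0 : 0 <= w%:R / 2 ^+ e + w%:R^-1 + 7 * rho :> R.
    by rewrite !addr_ge0 ?mulr_ge0 ?invr_ge0 ?exprn_ge0 ?ler0n.
  rewrite natr_sum.
  apply: (@le_trans _ _ (\sum_j (a j * N + h j)%:R * (w%:R / 2 ^+ e + w%:R^-1 + 7 * rho))).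
    apply: ler_sum => j _; apply: le_trans (sum_bad_divisors R P e z Y (h j) N (a0 j) w0) _.
    by rewrite ler_wpM2l ?ler0n // lerD2l.
  rewrite -mulr_suml ler_wpM2r // -natr_sum -natrM ler_nat.
  apply: (@leq_trans (\sum_j (a j + h j) * N)); last by rewrite -big_distrl /= leq_mul2r AP orbT.
  by apply: leq_sum => j _; rewrite mulnDl leq_add2l leq_pmulr.
have sp1 : forall n, `|smooth_part f a h w e n| <= 1 by exact: smooth_part_le1.
have Hper := has_mean_periodic (pnat_fact_exp w e)
  (@smooth_part_periodic _ f k a h w e) sp1.
have qw q : q \in Q -> prime q /\ (w < q)%N.
  by rewrite QP => /and3P[-> _ /andP[-> _]].
have th01 : {in Q, forall q, 0 <= (k%:R / q%:R : R[i]) <= 1}.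
  move=> q /qw[qp wq]; rewrite divr_ge0 ?ler0n // ler_pdivrMr ?ltr0n ?prime_gt0 //.
  by rewrite mul1r ler_nat; lia.
have M0 : (0 < w`! ^ e)%N by rewrite expn_gt0 fact_gt0.
have mean1 : `|(\sum_(r < w`! ^ e) smooth_part f a h w e r) / (w`! ^ e)%:R| <= 1.
  rewrite normrM normfV normr_nat ler_pdivrMr ?ltr0n // mul1r.
  apply: le_trans (ler_norm_sum _ _ _) _.
  apply: (@le_trans _ _ (\sum_(r < w`! ^ e) 1)).
    by apply: ler_sum => r _; exact: sp1.
  by rewrite sumr_const card_ord.
have sieve : `|S2| <= N%:R * (`|\prod_(q <- Q) (1 + (f q - 1) * (k%:R / q%:R))| +
      2 * (\prod_(b <- tower P i J) (1 + elsym b.1 (fun q => `|f q - 1| * (k%:R / q%:R)) b.2) - 1))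
    + ((w`! ^ e).+1 * \prod_(b <- tower P i J) (2 * k * size b.2 + 2) ^ b.1.+1)%:R.
  apply: (block_sieve N uQ _ Hper) => //.
  - by move=> p; rewrite inE => pw; rewrite QP ltnNge pw !andbF.
  - by move=> q /qw[qp wq]; exact: has_mean_divides_some.
  - by move=> q /qw[qp _]; apply: fU; exact: prime_gt0.
have exc : \prod_(b <- tower P i J) (1 + elsym b.1 (fun q => `|f q - 1| * (k%:R / q%:R)) b.2) - 1
   <= 4 * (2 * k%:R * rho)%:C.
  apply: tower_excess.
  - by move=> q; rewrite mulr_ge0 ?divr_ge0 ?ler0n.
  - by rewrite ler0c !mulr_ge0 ?ler0n.
  - have -> : 4 = (4 : R)%:C by rewrite rmorph_nat.
    by rewrite -rmorphM (_ : 1 = (1 : R)%:C) // lecR !mulrA -natrM; lra.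
  - move=> u /andP[u0 uJ]; rewrite big_filter.
    apply: (@le_trans _ _ ((2 * k%:R *
        \sum_((2 ^ 2 ^ (i - u)).+1 <= p < (2 ^ 2 ^ (i - u).+1).+1 | P p)
           p%:R^-1)%:C)).
      rewrite mulr_sumr rmorph_sum; apply: ler_sum => q /andP[qp _].
      rewrite rmorphM fmorphV rmorphM !rmorph_nat mulrA ler_wpM2r ?invr_ge0 ?ler0n //.
      rewrite ler_wpM2r ?ler0n // (le_trans (ler_normB _ _)) // normr1.
      by rewrite (_ : 2 = 1 + 1) // lerD2r fU // prime_gt0.
    by rewrite lecR ler_wpM2l ?mulr_ge0 ?ler0n // H // leq_sub2l.
have lev := tower_level P Ji kw.
set pi := `|\prod_(q <- Q) _| in sieve *.
have : `|S1| <= `|S1 - S2| + `|S2| by rewrite -{1}(subrK S2 S1) ler_normD.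
move/le_trans; apply.
apply: (le_trans (lerD approx sieve)).
set X := \prod_(b <- tower P i J) (1 + _) in exc *.
apply: (@le_trans _ _ ((2 * (A%:R * N%:R * (w%:R / 2 ^+ e + w%:R^-1 + 7 * rho)))%:C
  + (N%:R * (pi + 2 * (4 * (2 * k%:R * rho)%:C)) + ((w`! ^ e).+1 * 2 ^ 2 ^ (i + 4))%:R))).
  apply: lerD.
    rewrite rmorphM rmorph_nat ler_wpM2l ?ler0n //.
    by rewrite -(rmorph_nat (real_complex R)) lecR.
  apply: lerD; first by rewrite ler_wpM2l ?ler0n // lerD2l ler_wpM2l ?ler0n.
  by rewrite ler_nat leq_mul2l lev orbT.
rewrite le_eqVlt; apply/orP; left; apply/eqP.
rewrite !rmorphD !rmorphM !rmorph_nat.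
by ring.
Qed.

End Assembly.

Section Final.
Variable R : realType.

Lemma double_log N i : (2 ^ 2 ^ i <= N)%N ->
  exists2 t, (i <= t)%N & (2 ^ 2 ^ t <= N < 2 ^ 2 ^ t.+1)%N.
Proof.
move=> iN; exists (trunc_log 2 (trunc_log 2 N)).
  by apply: trunc_log_max => //; apply: trunc_log_max.
have N0 : (0 < N)%N by apply: leq_trans iN; rewrite expn_gt0.
have l0 : (0 < trunc_log 2 N)%N.
  rewrite trunc_log_gt0 /=; apply: leq_trans iN.
  by rewrite -[2%N]expn1 leq_exp2l // expn_gt0.
apply/andP; split.
  by apply: leq_trans (trunc_logP (ltnSn 1) N0); rewrite leq_exp2l // trunc_logP.
apply: (leq_trans (trunc_log_ltn N (ltnSn 1))).
by rewrite leq_exp2l // trunc_log_ltn.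
Qed.

(** The primes with f p = 1 add nothing to the divergent sum, and those up to w
    only a constant, so the sum over Q diverges as z grows. *)
Lemma euler_product_small (f : nat -> R[i]) (k w : nat) (eps : R) :
  unit_disk_valued f -> ~ pretentious f -> (0 < k)%N -> (2 * k <= w)%N ->
  0 < eps ->
  exists n0, forall (z : nat) (Q : seq nat), (n0 <= z)%N -> uniq Q ->
    (forall p, (p \in Q) = [&& prime p, f p != 1 & (w < p <= z)%N]) ->
    `|\prod_(q <- Q) (1 + (f q - 1) * (k%:R / q%:R))| <= eps%:C.
Proof.
move=> fU nonpret k0 kw eps0.
pose s p : R := (1 - complex.Re (f p)) / p%:R.
have s0 p : prime p -> 0 <= s p.
  move=> pp; rewrite divr_ge0 ?ler0n // subr_ge0 Re_le1 // fU //.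
  exact: prime_gt0.
have [n0 Hn0] := nonpretentious_diverges fU nonpret
  (eps ^- 2 + \sum_(0 <= p < w.+1 | prime p) s p).
exists (maxn n0 w) => z Q; rewrite geq_max => /andP[nz wz] uQ QP.
have QS : eps ^- 2 <= \sum_(q <- Q) s q.
  have -> : \sum_(q <- Q) s q = \sum_(w.+1 <= p < z.+1 | prime p) s p.
    rewrite [RHS](bigID (fun p => f p == 1)) /= [X in _ = X + _]big1 ?add0r; last first.
      by move=> p /andP[_ /eqP fp]; rewrite /s fp /= subrr mul0r.
    rewrite -[RHS]big_filter; apply: perm_big; apply: uniq_perm => //.
      by rewrite filter_uniq // iota_uniq.
    by move=> p; rewrite mem_filter mem_index_iota QP ltnS -andbA.
  rewrite -(lerD2l (\sum_(0 <= p < w.+1 | prime p) s p)).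
  rewrite -big_cat_nat //= addrC (le_trans Hn0) //.
  by rewrite [leRHS](@big_cat_nat _ _ _ n0) //= ?(leq_trans nz) // lerDl sumr_ge0.
have Qq : {in Q, forall q, `|f q| <= 1 /\ (2 * k <= q)%N}.
  move=> q; rewrite QP => /and3P[pq _ /andP[wq _]].
  by rewrite fU ?prime_gt0 // (leq_trans kw) // ltnW.
have := euler_factors_decay k0 Qq.
rewrite -/(\sum_(q <- Q) s q) => le.
rewrite -(@ler_pXn2r _ 2) ?nnegrE ?normr_ge0 ?ler0c ?(ltW eps0) //.
apply: le_trans le _; rewrite -rmorphXn lecR.
have e2 : 0 < eps ^+ 2 by rewrite exprn_gt0.
rewrite -[leRHS]invrK lef_pV2 ?posrE ?invr_gt0 //; last first.
  by rewrite ltr_wpDr // (le_trans _ QS) // invr_ge0 ltW.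
by rewrite (le_trans QS) // lerDr.
Qed.

(** Constants are chosen in the order rho (block mass), w = 2^2^i0, e, and then N.
    The four errors are at most eps/4 each: the block masses, the bad divisors
    of the other kinds, the Euler product, and the remainder of the sieve. *)
Lemma correlation_small (f : nat -> R[i]) (k : nat) (a h : 'I_k -> nat) (eps : R) :
  unit_disk_valued f -> multiplicative_function f -> ~ pretentious f ->
  relative_density0_in_primes R [pred p | prime p && (f p != 1)] ->
  (0 < k)%N -> (forall i, (0 < a i)%N) -> (forall i, (0 < h i)%N) ->
  (forall i j, i != j -> (a i * h j != a j * h i)%N) -> 0 < eps ->
  exists N0, forall N, (N0 <= N)%N ->
  `|\sum_(1 <= n < N.+1) \prod_j f (a j * n + h j)%N| <= (eps * N%:R)%:C.
Proof.
move=> fU fM nonpret dens k0 a0 h0 ah eps0.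
set A := (\sum_i (a i + h i))%N.
set m := Num.min 1 eps.
have m0 : 0 < m by rewrite lt_min ltr01.
have m1 : m <= 1 by rewrite ge_min lexx.
have me : m <= eps by rewrite ge_min lexx orbT.
have kA0 : 0 < (A + k)%:R :> R by rewrite ltr0n addn_gt0 k0 orbT.
pose rho : R := m / (64 * (A + k)%:R).
have rho0 : 0 < rho by rewrite divr_gt0 // mulr_gt0.
have rhoE : 64 * (A + k)%:R * rho = m by rewrite mulrC divfK // gt_eqF // mulr_gt0.
have [j0 block_small] := block_sums_small rho0 dens.
have [w1 Hw1] := natr_unbounded (16 * A%:R / eps).
have [i0 [j0i w1i ki ahi]] : exists i0, [/\ (j0 <= i0)%N, (w1 <= i0)%N,
    (2 * k + 2 <= i0)%N & forall i j, (a i * h j <= i0)%N].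
  exists (j0 + w1 + (2 * k + 2) + \sum_i \sum_j a i * h j)%N.
  split=> [|||i j]; [lia..|].
  by rewrite (bigD1 i) //= (bigD1 j) //= addnC -!addnA leq_addr.
pose w := (2 ^ 2 ^ i0)%N.
have i0w : (i0 <= w)%N := leq_exp22_id i0.
have [e0 He0] := natr_unbounded (16 * A%:R * w%:R / eps).
have He : 16 * A%:R * w%:R / eps <= 2 ^+ e0.
  by rewrite (le_trans He0) // -natrX ler_nat ltnW // ltn_expl.
have eps4 : 0 < eps / 4 by rewrite divr_gt0.
have kw2 : (2 * k <= w)%N by rewrite (leq_trans _ i0w) // (leq_trans _ ki) // leq_addr.
have [n0 Hn0] := euler_product_small fU nonpret k0 kw2 eps4.
have [n1 Hn1] := natr_unbounded ((w`! ^ e0).+1%:R * 4 / eps : R).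
have [imin [i0m n0m n1m]] :
    exists imin, [/\ (i0 <= imin)%N, (n0 <= imin)%N & (n1 <= imin)%N].
  exists (i0 + n0 + n1)%N; split; last exact: leq_addl.
    by rewrite -addnA leq_addr.
  by rewrite addnAC leq_addl.
exists (A + 2 ^ 2 ^ (imin + 5))%N => N NN0.
have [t it tN] : exists2 t, (imin + 5 <= t)%N & (2 ^ 2 ^ t <= N < 2 ^ 2 ^ t.+1)%N.
  by apply: double_log; apply: leq_trans NN0; rewrite leq_addl.
(* With t - 5 the remainder of the sieve is a constant times 2^2^(t - 1), which
   is at most sqrt N. *)
pose i := (t - 5)%N.
have tE : (t = i + 5)%N by rewrite subnK // (leq_trans _ it) // leq_addl.
have ii : (imin <= i)%N by rewrite -(leq_add2r 5) -tE.
pose J := (i - i0)%N.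
have iJ : (i - J = i0)%N by rewrite subKn // (leq_trans i0m).
have ahw i' j' : (a i' * h j' <= w)%N by rewrite (leq_trans (ahi _ _)).
have pos c : 0 <= c%:R :> R by rewrite ler0n.
have N0 : 0 < N%:R :> R by rewrite ltr0n; case/andP: tN => tN _; apply: leq_trans tN; rewrite expn_gt0.
have AN : (A <= N)%N by apply: leq_trans NN0; rewrite leq_addr.
have := @correlation_bound R f k a h rho e0 i J t N A.
rewrite iJ -/w => bound.
apply: le_trans (bound fU fM k0 a0 h0 ah ahw _ (leq_subr _ _) tE tN (leqnn _) AN (ltW rho0) _ _) _.
- by rewrite (leq_trans ki).
- have := pos A; move: rhoE; rewrite natrD; nra.
- by move=> l il; apply: block_small; rewrite (leq_trans j0i).
set Q := flatten _; set pi := `|_|.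
have pi_small : pi <= (eps / 4)%:C.
  apply: (Hn0 (2 ^ 2 ^ i)%N).
  - by rewrite (leq_trans n0m) // (leq_trans ii) // leq_exp22_id.
  - by rewrite uniq_tower // leq_subr.
  - by move=> p; rewrite mem_tower ?leq_subr //= iJ -andbA.
have level : ((w`! ^ e0).+1 * 2 ^ 2 ^ (i + 4))%:R <= eps / 4 * N%:R.
  set T := (2 ^ 2 ^ (i + 4))%N.
  have TN : (T * T <= N)%N.
    by case/andP: tN => tN _; rewrite -expnD addnn -mul2n -expnS -addnS -tE.
  have n1T : (w`! ^ e0).+1%:R * 4 / eps <= T%:R.
    rewrite (le_trans Hn1) // ler_nat (leq_trans _ (leq_exp22_id _)) //.
    by rewrite (leq_trans n1m) // (leq_trans ii) // leq_addr.
  rewrite natrM; apply: (@le_trans _ _ (eps / 4 * (T * T)%:R)); last first.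
    by rewrite ler_wpM2l ?ler_nat // ltW.
  rewrite natrM mulrA ler_wpM2r //.
  by move: n1T; rewrite ler_pdivrMr // => n1T; lra.
have w0 : 0 < w%:R :> R by rewrite ltr0n expn_gt0.
have main : 2 * A%:R * (w%:R / 2 ^+ e0 + w%:R^-1 + 7 * rho) + 16 * k%:R * rho <= eps / 2.
  have h1 : 2 * A%:R * (w%:R / 2 ^+ e0) <= eps / 8.
    rewrite mulrA ler_pdivrMr ?exprn_gt0 //.
    by move: He; rewrite ler_pdivrMr // => He; lra.
  have h2 : 2 * A%:R * w%:R^-1 <= eps / 8.
    rewrite ler_pdivrMr //.
    have : 16 * A%:R / eps <= w%:R.
      by rewrite (le_trans Hw1) // ler_nat (leq_trans w1i).
    by rewrite ler_pdivrMr // => h2; lra.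
  have h3 : 14 * A%:R * rho + 16 * k%:R * rho <= eps / 4.
    have := pos A; move: rhoE; rewrite natrD; nra.
  by rewrite !mulrDr; lra.
apply: (@le_trans _ _ ((N%:R * (eps / 2) + eps / 4 * N%:R)%:C + N%:R * (eps / 4)%:C)).
  apply: lerD; last by rewrite ler_wpM2l ?ler0n.
  by rewrite lecR lerD // ler_wpM2l.
rewrite -(rmorph_nat (real_complex R)) -rmorphM -rmorphD lecR.
by rewrite le_eqVlt; apply/orP; left; apply/eqP; field.
Qed.

End Final.

Theorem theorem1p2 (R : realType) (f : nat -> R[i])
  (f_disk : unit_disk_valued f)
  (f_mult : multiplicative_function f)
  (f_nonpret : ~ pretentious f)
  (f_density : relative_density0_in_primes R [pred p | prime p && (f p != 1)]) :
  satisfies_elliott f.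
Proof.
move=> k a h k0 a0 h0 ah.
apply: (proj2 (@cvgrPdist_le R[i] R[i]^o R (+oo)%classic _ _ _)) => /= e e0.
have eE : e = (complex.Re e)%:C by rewrite RRe_real // gtr0_real.
have r0 : 0 < complex.Re e by move: e0; rewrite eE ltcR.
have [N0 H] := correlation_small f_disk f_mult f_nonpret f_density k0 a0 h0 ah r0.
near=> x.
have x0 : 0 < x by near: x; exact: nbhs_pinfty_gt.
have N0x : (N0 <= Num.truncn x)%N.
  rewrite -ltnS -(ltr_nat R); apply: le_lt_trans (truncnS_gt x).
  by near: x; exact: nbhs_pinfty_ge.
rewrite sub0r normrN normrM.
have xC : 0 < x%:C by rewrite ltcR.
rewrite normfV (gtr0_norm xC) mulrC ler_pdivrMr //.
apply: le_trans (H _ N0x) _.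
rewrite eE -rmorphM lecR ler_wpM2l ?(ltW r0) //.
by rewrite truncn_le ltW.
Unshelve. all: by end_near.
Qed.
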